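(* Let $N\ge1$ and $0<\gamma<\min\{2,N\}$. Suppose that $f\in C^2([0,\infty))\cap S_q$ with $q\in[1,\infty)$ and that, for some sufficiently small $\delta\in(0,1)$, $$\frac{f(\xi)f''(\xi)}{(f'(\xi))^2}\ge\delta\quad\text{for all }\xi>0$$ (in particular $f'(\xi)\neq0$ for $\xi>0$). Let $0<r<N/(2-\gamma)$ and $q\le 1+r$, and let $F(u)=\int_u^\infty\frac{d\tau}{f(\tau)}$. Then there exists a nonnegative initial function $u_0\in L^1_{\rm ul}(\mathbb{R}^N)$ such that $F(u_0)^{-r}\in L^1_{\rm ul}(\mathbb{R}^N)$ and the Cauchy problem $$\partial_t u-\Delta u=|x|^{-\gamma}f(u)\ \ (x\in\mathbb{R}^N,\ t\in(0,T)),\qquad u(x,0)=u_0(x)\ \ (x\in\mathbb{R}^N)$$ does not have nonnegative local-in-time solutions (that is, for no $T>0$ is there a nonnegative local-in-time solution in $\mathbb{R}^N\times(0,T)$).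
   Context: Uniformly local space: $B(y,\rho)=\{x\in\mathbb{R}^N: |x-y|<\rho\}$; $L^1_{\rm ul}(\mathbb{R}^N)$ is the set of $u\in L^1_{\rm loc}(\mathbb{R}^N)$ with $\|u\|_{L^1_{\rm ul}(\mathbb{R}^N)}:=\sup_{y\in\mathbb{R}^N}\int_{B(y,1)}|u(x)|\,dx<\infty$. Class $S_q$: for $q\in\mathbb{R}$, $S_q$ is the set of $f\in C([0,\infty))$ such that $f\in C^1((0,\infty))$, $f(u)>0$, $f'(u)\ge 0$ and $F(u):=\int_u^\infty \frac{d\tau}{f(\tau)}<\infty$ for all $u>0$, and the limit $\lim_{\xi\to\infty}f'(\xi)F(\xi)$ exists and equals $q$. One allows $F(0)=\int_0^\infty \frac{d\tau}{f(\tau)}\in(0,\infty]$, with $F(0)^{-r}=0$ if $F(0)=\infty$. Heat semigroup: $[e^{t\Delta}\phi](x)=\int_{\mathbb{R}^N}G(x-y,t)\phi(y)\,dy$ with $G(x,t)=(4\pi t)^{-N/2}\exp(-|x|^2/(4t))$. Solution: a nonnegative measurable function $u$ is a local-in-time solution of the Cauchy problem in $\mathbb{R}^N\times(0,T)$ (where $T>0$) if $u\in L^\infty((0,T),L^1_{\rm ul}(\mathbb{R}^N))\cap L^\infty_{\rm loc}((0,T),L^\infty(\mathbb{R}^N))$ and $$u(x,t)=[e^{t\Delta}u_0](x)+\int_0^t[e^{(t-s)\Delta}|\cdot|^{-\gamma}f(u(\cdot,s))](x)\,ds$$ for a.a. $x\in\mathbb{R}^N$, $0<t<T$. *)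

(* Defs.v *)
From HB Require Import structures.
From mathcomp Require Import all_boot all_order all_algebra.
From mathcomp Require Import all_classical all_reals all_analysis.

Set Implicit Arguments.
Unset Strict Implicit.
Unset Printing Implicit Defensive.

Import Order.TTheory GRing.Theory Num.Theory.
Import numFieldNormedType.Exports.

Local Open Scope classical_set_scope.
Local Open Scope ring_scope.

(* Points of R^N are tuples [N.-tuple R], which carry the product (Borel)
   sigma-algebra of the library. *)

Section lebesgue_measure_tuple.
Context {R : realType}.
Local Open Scope ereal_scope.

Definition cons_pair n (p : measurableTypeR R * n.-tuple R) : n.+1.-tuple R :=
  [tuple of (p.1 : R) :: p.2].

Lemma measurable_cons_pair n : measurable_fun setT (@cons_pair n).
Proof.
apply: (measurable_cons (f := fun p : measurableTypeR R * n.-tuple R => p.1 : R)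
  (g := snd)).
  exact: measurable_fst.
exact: measurable_snd.
Qed.

Section step.
Variables (n : nat) (m : {sigma_finite_measure set (n.-tuple R) -> \bar R}).

Definition lebesgue_cons : set (n.+1.-tuple R) -> \bar R :=
  pushforward (lebesgue_measure \x m) (@cons_pair n).

Let pf : {measure set (n.+1.-tuple R) -> \bar R} :=
  measure_function_pushforward__canonical__measure_function_Measure
    (lebesgue_measure \x m) (@measurable_cons_pair n).

Let lebesgue_cons0 : lebesgue_cons set0 = 0.
Proof. exact: (measure0 pf). Qed.

Let lebesgue_cons_ge0 A : 0 <= lebesgue_cons A.
Proof. exact: (measure_ge0 pf). Qed.

Let lebesgue_cons_sigma_additive : semi_sigma_additive lebesgue_cons.
Proof. exact: (@measure_semi_sigma_additive _ _ _ pf). Qed.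

HB.instance Definition _ := isMeasure.Build _ _ _
  lebesgue_cons lebesgue_cons0 lebesgue_cons_ge0 lebesgue_cons_sigma_additive.

Let lebesgue_cons_sigma_finite : sigma_finite setT lebesgue_cons.
Proof.
have /sigma_finiteP[F [TF ndF Foo]] := sigma_finiteT
  (lebesgue_measure : {sigma_finite_measure set (measurableTypeR R) -> \bar R}).
have /sigma_finiteP[G [TG ndG Goo]] := sigma_finiteT m.
pose g (t : n.+1.-tuple R) : measurableTypeR R * n.-tuple R :=
  (thead t, [tuple of behead t]).
have gK p : g (cons_pair p) = p.
  case: p => a t; rewrite /g /cons_pair /=; congr pair.
  exact/val_inj.
have mg : measurable_fun setT g.
  apply/measurable_fun_pairP; split => /=.
    exact: (@measurable_tnth _ R n.+1 ord0).
  exact: measurable_behead.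
exists (fun k => g @^-1` (F k `*` G k)).
  apply/seteqP; split => t _ //.
  have [i _ Fi] : (\bigcup_i F i) (g t).1 by rewrite -TF.
  have [j _ Gj] : (\bigcup_i G i) (g t).2 by rewrite -TG.
  exists (maxn i j) => //; split.
    by move: Fi; exact/subsetPset/ndF/leq_maxl.
  by move: Gj; exact/subsetPset/ndG/leq_maxr.
move=> k; have [mF Fk] := Foo k; have [mG Gk] := Goo k; split.
  by rewrite -[X in measurable X]setTI; apply: mg => //; exact: measurableX.
rewrite /lebesgue_cons /pushforward -comp_preimage (_ : g \o _ = idfun).
  by rewrite preimage_id product_measure1E// lte_mul_pinfty// ge0_fin_numE.
by apply/funext => p; exact: gK.
Qed.

HB.instance Definition _ := Measure_isSigmaFinite.Build _ _ _
  lebesgue_cons lebesgue_cons_sigma_finite.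
End step.

(* N-dimensional Lebesgue measure, as the N-fold product of the
   one-dimensional one. *)
Fixpoint lebesgueN n : {sigma_finite_measure set (n.-tuple R) -> \bar R} :=
  match n with
  | 0%N => (\d_([tuple] : 0.-tuple R) : {sigma_finite_measure set _ -> \bar R})
  | n'.+1 => (lebesgue_cons (lebesgueN n') : {sigma_finite_measure set _ -> \bar R})
  end.

Lemma lebesgueN_box n (A : 'I_n -> set R) : (forall i, measurable (A i)) ->
  lebesgueN n [set x | forall i, A i (tnth x i)] =
  \prod_(i < n) lebesgue_measure (A i).
Proof.
elim: n A => [|n IH] A mA.
  rewrite big_ord0 /= diracE mem_set//=; by case.
rewrite big_ord_recl -IH; last by move=> i; exact: mA.
have mB : measurable [set x : n.-tuple R | forall i, A (lift ord0 i) (tnth x i)].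
  rewrite [X in measurable X](_ : _ = \bigcap_(i in [set: 'I_n])
    (fun x : n.-tuple R => tnth x i) @^-1` (A (lift ord0 i))).
    apply: fin_bigcap_measurable => // i _.
    by rewrite -[X in measurable X]setTI; exact: (measurable_tnth i).
  by apply/seteqP; split => x /= H i; [move=> _; apply: H | apply: H].
have := product_measure1E lebesgue_measure (lebesgueN n) (mA ord0) mB.
move=> <-.
congr (product_measure1 _ _ _); apply/seteqP; split => -[a t] /=.
  move=> H; split; first exact: (H ord0).
  by move=> i; have := H (lift ord0 i); rewrite tnthS.
move=> [Aa At] i; case: (unliftP ord0 i) => [j ->|->//].
by rewrite tnthS.
Qed.
End lebesgue_measure_tuple.

Section euclidean_space.
Context {R : realType} (N : nat).
Implicit Types x y : N.-tuple R.

Definition vsub x y : N.-tuple R := [tuple tnth x i - tnth y i | i < N].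

Definition enorm x : R := Num.sqrt (\sum_(i < N) tnth x i ^+ 2).

Definition eball y (rho : R) : set (N.-tuple R) :=
  [set x | enorm (vsub x y) < rho].

(* Every compact subset of R^N lies in a ball centered at the origin. *)
Definition L1loc (phi : N.-tuple R -> R) : Prop :=
  measurable_fun setT phi /\
  forall rho : R, (\int[lebesgueN N]_(x in eball [tuple 0%R | i < N] rho)
    `|phi x|%:E < +oo)%E.

Definition L1ul_norm (phi : N.-tuple R -> R) : \bar R :=
  ereal_sup (range (fun y =>
    (\int[lebesgueN N]_(x in eball y 1) `|phi x|%:E)%E)).

Definition L1ul (phi : N.-tuple R -> R) : Prop :=
  L1loc phi /\ (L1ul_norm phi < +oo)%E.

Definition gauss x (t : R) : R :=
  (4 * pi * t) `^ (- (N%:R / 2)) * expR (- (enorm x ^+ 2 / (4 * t))).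

Definition heat (t : R) (phi : N.-tuple R -> R) x : \bar R :=
  (\int[lebesgueN N]_y (gauss (vsub x y) t * phi y)%:E)%E.

End euclidean_space.

Section nonlinearity.
Context {R : realType}.
Implicit Types f g : R -> R.

(* Functions on [0, +oo[ are represented by f : R -> R; only the values on
   [0, +oo[ matter. *)

Definition tail_int f (u : R) : \bar R :=
  (\int[lebesgue_measure]_(tau in `]u, +oo[) ((f tau)^-1)%:E)%E.

Definition tail_int_pow f (r u : R) : R :=
  if tail_int f u == +oo%E then 0 else fine (tail_int f u) `^ (- r).

(* g is the derivative of f relative to [0, +oo[: two-sided at x > 0,
   from the right at 0. *)
Definition deriv_nneg f g : Prop :=
  forall x : R, 0 <= x ->
    (f y - f x) / (y - x) @[y --> within `[0, +oo[ (x^')] --> g x.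

Definition C2_nneg f : Prop :=
  exists g h, [/\ deriv_nneg f g, deriv_nneg g h &
    [/\ {within `[0, +oo[, continuous f}, {within `[0, +oo[, continuous g} &
        {within `[0, +oo[, continuous h}]].

Definition classS (q : R) f : Prop :=
  [/\ {within `[0, +oo[, continuous f},
      forall u : R, 0 < u -> derivable f u 1,
      {within `]0, +oo[, continuous (f^`())%classic},
      forall u : R, 0 < u ->
        [/\ 0 < f u, 0 <= (f^`())%classic u & (tail_int f u < +oo)%E] &
      (f^`())%classic xi * fine (tail_int f xi) @[xi --> +oo] --> q].

End nonlinearity.

Section solution.
Context {R : realType} (N : nat).

(* [0 `^ (- gamma) = 0] for gamma <> 0; the origin is a null set when N > 0. *)
Definition duhamel (gamma : R) (f : R -> R) (u : N.-tuple R -> R -> R)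
    (x : N.-tuple R) (t : R) : \bar R :=
  (\int[lebesgue_measure]_(s in `]0%R, t[)
    heat (t - s)%R (fun y => enorm y `^ (- gamma) * f (u y s))%R x)%E.

(* The spaces L^oo((0,T), X) and L^oo_loc((0,T), X) are expressed through
   representatives u : R^N -> R -> R.  The Duhamel formula is an equality in
   \bar R, all integrands being nonnegative; it is required for almost every
   (x, t) with respect to the product measure. *)
Definition local_solution (gamma : R) (f : R -> R) (u0 : N.-tuple R -> R)
    (T : R) (u : N.-tuple R -> R -> R) : Prop :=
  [/\ measurable_fun
        ([set: N.-tuple R] `*` `]0, T[ : set (N.-tuple R * measurableTypeR R))
        (fun p => u p.1 p.2),
      forall x t, 0 < t < T -> 0 <= u x t,
      exists M : R, {ae lebesgue_measure, forall t : R, 0 < t < T ->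
        L1ul (u ^~ t) /\ (L1ul_norm (u ^~ t) <= M%:E)%E},
      forall a b : R, 0 < a -> b < T ->
        exists M : R, {ae lebesgue_measure, forall t : R, a <= t <= b ->
          (Lnorm (lebesgueN N) +oo (EFin \o u ^~ t) <= M%:E)%E} &
      {ae (lebesgueN N \x lebesgue_measure)%E, forall p : N.-tuple R * R,
        0 < p.2 < T ->
        (u p.1 p.2)%:E = (heat p.2 u0 p.1 + duhamel gamma f u p.1 p.2)%E}].

End solution.

(* Main.v *)
Require Import Defs.
From mathcomp Require Import all_boot all_order all_algebra.
From mathcomp Require Import all_classical all_reals all_analysis measurable_realfun.
From mathcomp Require Import ring lra.

Set Implicit Arguments.
Unset Strict Implicit.
Unset Printing Implicit Defensive.

Import Order.TTheory GRing.Theory Num.Theory.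
Import numFieldNormedType.Exports.

Local Open Scope classical_set_scope.
Local Open Scope ring_scope.

(** The initial datum is singular at the origin: [F(u0(x)) = |x| ^ a] near [0],
    where [2 - gamma < a < N / r]. There is room for [a] because
    [r < N / (2 - gamma)].

    Integrability. By construction [F(u0) ^ -r] is [|x| ^ (- a r)] near the
    origin and bounded elsewhere, and [a r < N]. The limit [q] of [f' F] controls
    the growth of [F^-1]: for every [s > q - 1], [u] is at most a multiple of
    [F(u) ^ -s] on [u >= 1] ([tail_growth]). As [q - 1 <= r], one may take [s > r] with
    [a s < N], so that [u0], at most a multiple of [|x| ^ (- a s)] near the
    origin, is integrable as well.

    Non-existence. Let [u] be a solution and, for a fixed point [(x, t)] with
    [|x|^2 <= t], let [W(s)] be the value at [x] of the heat flow over time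
    [t - s] applied to [u(s)]. By the Duhamel formula and the semigroup property,
    [W(s)] equals [W(0)] plus the integral over [0, s] of the heat flow of the
    source [|y| ^ -gamma f(u)], and it stays below the finite number [u(x, t)].
    The hypothesis on [f f''] says that a power of [f] with exponent smaller than
    1 is convex. This leaves enough convexity to apply Jensen's inequality in spite
    of the weight, at the price of a factor of the order of [|y| ^ -gamma] at the
    parabolic scale [t ^ (1/2)] ([heat_weighted_jensen]):
    [W' >= c t ^ (- gamma / 2) f(W)]. Integrating this differential inequality
    ([lifespan_le]) gives the necessary condition
    [c t ^ (1 - gamma / 2) <= F(W(0))], where [W(0)] is the heat flow of [u0]
    ([local_solution_lifespan]).

    On the other hand [F] is convex, so by Jensen's inequality again [F(W(0))] is at
    most the heat flow of [F(u0) <= |x| ^ a], which is of order [t ^ (a / 2)]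
    ([tail_heat_le]). Since [a / 2 > 1 - gamma / 2], the two bounds contradict each
    other as [t] tends to 0. *)

(** * Integration over tuples *)

Section euclidean_integration.
Context {R : realType}.
Local Open Scope ereal_scope.

(** Tonelli, along the first coordinate. *)
Lemma integral_lebesgueNS n (f : n.+1.-tuple R -> \bar R) :
  measurable_fun setT f -> (forall x, 0 <= f x) ->
  \int[lebesgueN n.+1]_x f x =
  \int[lebesgue_measure]_a \int[lebesgueN n]_t f (cons_pair (a, t)).
Proof.
move=> mf f0.
transitivity (\int[pushforward (lebesgue_measure \x lebesgueN n) (@cons_pair R n)]_x f x).
  by [].
rewrite ge0_integral_pushforward//; last exact: measurable_cons_pair.
rewrite preimage_setT fubini_tonelli1//=.
apply: measurableT_comp => //; exact: measurable_cons_pair.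
Qed.

(** All Gaussian integrals in dimension [n] reduce to one-dimensional ones by
    this factorization. *)
Lemma integral_lebesgueN_prod n (g : 'I_n -> R -> R) :
  (forall i, measurable_fun setT (g i)) -> (forall i y, (0 <= g i y)%R) ->
  \int[lebesgueN n]_x (\prod_(i < n) g i (tnth x i))%:E =
  \prod_(i < n) \int[lebesgue_measure]_y (g i y)%:E.
Proof.
elim: n g => [|n IH] g mg g0.
  rewrite /= integral_dirac//= ?diracT ?mul1e ?big_ord0//.
  apply/measurable_EFinP.
  rewrite (_ : (fun _ => _) = cst 1%R)//; by apply/funext => x; rewrite big_ord0.
rewrite integral_lebesgueNS; last 2 first.
- apply/measurable_EFinP; apply: measurable_prod => i _.
  by apply: measurableT_comp => //; exact: measurable_tnth.
- by move=> x; rewrite lee_fin prodr_ge0.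
rewrite big_ord_recl.
under eq_integral => a _.
  under eq_integral => t _.
    rewrite big_ord_recl EFinM /=.
    under eq_bigr do rewrite tnthS.
    rewrite (_ : tnth _ ord0 = a)//.
    over.
  rewrite ge0_integralZl//; last 3 first.
  - apply/measurable_EFinP; apply: measurable_prod => i _.
    by apply: measurableT_comp => //; exact: measurable_tnth.
  - by move=> t _; rewrite lee_fin prodr_ge0.
  - by rewrite lee_fin.
  rewrite (IH (fun i => g (lift ord0 i)))//.
  over.
rewrite ge0_integralZr//.
- by apply/measurable_EFinP; exact: mg.
- by move=> x _; rewrite lee_fin.
- by apply: prode_ge0 => i _; apply: integral_ge0 => y _; rewrite lee_fin.
Qed.

End euclidean_integration.

(** * The heat kernel and its semigroup property *)

Section heat_kernel.
Context {R : realType}.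

(** Writing [x^-1] as [x * (x ^ 2)^-1] makes the base of the inverse
    nonnegative, where the inverse is the power of exponent [-1]; the identity
    also holds at [0]. *)
Lemma measurable_inv : measurable_fun setT (@GRing.inv R).
Proof.
rewrite (_ : @GRing.inv R = fun x => x * (x ^+ 2) `^ (-1)); last first.
  apply/funext => x; rewrite powR_inv1 ?sqr_ge0//.
  have [->|x0] := eqVneq x 0; first by rewrite invr0 mul0r.
  by field.
apply: measurable_funM => //.
by apply: (measurableT_comp (@measurable_powR R _)); exact: measurable_funX.
Qed.

Definition heat1 (t z : R) : R :=
  (4 * pi * t) `^ (- 2^-1) * expR (- (z ^+ 2 / (4 * t))).

Lemma heat1_ge0 t z : 0 <= heat1 t z.
Proof. by rewrite mulr_ge0 ?powR_ge0 ?expR_ge0. Qed.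

Lemma heat1E t m y : 0 < t -> heat1 t (m - y) = normal_pdf m (Num.sqrt (2 * t)) y.
Proof.
move=> t0; have t2 : 0 < 2 * t by rewrite mulr_gt0.
rewrite normal_pdfE ?gt_eqF ?sqrtr_gt0// /normal_peak /normal_fun /heat1.
rewrite sqr_sqrtr ?ltW// powRN powR12_sqrt; last first.
  by apply: mulr_ge0; [apply: mulr_ge0 => //; exact: pi_ge0|exact: ltW].
congr (_ ^-1 * expR _).
  congr Num.sqrt; ring.
rewrite -sqrrN opprB mulNr; congr (- (_ / _)); ring.
Qed.

Lemma integral_heat1 t m : 0 < t ->
  (\int[lebesgue_measure]_y (heat1 t (m - y))%:E = 1)%E.
Proof.
move=> t0; under eq_integral do rewrite heat1E//.
by rewrite integral_normal_pdf.
Qed.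

(** Completing the square: as a function of [y], the product of two Gaussians is
    a multiple of a single Gaussian, centered at the barycenter of [x] and
    [z]. *)
Lemma heat1_mul (a b x y z : R) : 0 < a -> 0 < b ->
  heat1 a (x - y) * heat1 b (y - z) =
  heat1 (a + b) (x - z) *
  heat1 (a * b / (a + b)) ((b * x + a * z) / (a + b) - y).
Proof.
move=> a0 b0; have ab0 : 0 < a + b by rewrite addr_gt0.
have pi0 := @pi_gt0 R.
have c (t : R) : 0 < t -> 0 <= 4 * pi * t by move=> t0; apply/ltW/mulr_gt0 => //; exact: mulr_gt0.
rewrite /heat1 mulrACA [RHS]mulrACA -!expRD -!powRM; last 4 first.
  by apply: c.
  by apply: c; rewrite divr_gt0// mulr_gt0.
  by apply: c.
  by apply: c.
congr (_ `^ _ * expR _); field; rewrite ?gt_eqF//.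
Qed.

Lemma measurable_heat1 t : measurable_fun setT (heat1 t).
Proof.
apply: measurable_funM; first exact: measurable_cst.
apply: measurableT_comp; first exact: measurable_expR.
apply: measurable_funN.
by apply: measurable_funM; [exact: measurable_funX|exact: measurable_cst].
Qed.

Lemma heat1_semigroup a b x z : 0 < a -> 0 < b ->
  (\int[lebesgue_measure]_y (heat1 a (x - y) * heat1 b (y - z))%:E =
   (heat1 (a + b) (x - z))%:E)%E.
Proof.
move=> a0 b0.
under eq_integral do rewrite heat1_mul// EFinM.
rewrite ge0_integralZl//.
- by rewrite integral_heat1 ?mule1// divr_gt0 ?mulr_gt0 ?addr_gt0.
- apply/measurable_EFinP; apply: (measurableT_comp (measurable_heat1 _)).
  exact: measurable_funB.
- by move=> y _; rewrite lee_fin heat1_ge0.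
- by rewrite lee_fin heat1_ge0.
Qed.

Variable N : nat.
Implicit Types x y z : N.-tuple R.

Lemma tnth_vsub x y i : tnth (vsub x y) i = tnth x i - tnth y i.
Proof. by rewrite tnth_mktuple. Qed.

Lemma sqr_enorm x : enorm x ^+ 2 = \sum_(i < N) tnth x i ^+ 2.
Proof. by rewrite sqr_sqrtr// sumr_ge0// => i _; rewrite sqr_ge0. Qed.

Lemma gauss_prod x t : 0 < t -> gauss x t = \prod_(i < N) heat1 t (tnth x i).
Proof.
move=> t0; rewrite /gauss /heat1 big_split/= prodr_const card_ord.
congr (_ * _).
  by rewrite -powR_mulrn ?powR_ge0// -powRrM; congr (_ `^ _); ring.
rewrite sqr_enorm -expR_sum sumrN; congr (expR (- _)).
by rewrite mulr_suml.
Qed.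

Lemma gauss_ge0 x t : 0 <= gauss x t.
Proof. by rewrite mulr_ge0 ?powR_ge0 ?expR_ge0. Qed.

Lemma integral_gauss x t : 0 < t ->
  (\int[lebesgueN N]_y (gauss (vsub x y) t)%:E = 1)%E.
Proof.
move=> t0.
under eq_integral => y _.
  rewrite gauss_prod//.
  under eq_bigr do rewrite tnth_vsub.
  over.
rewrite (@integral_lebesgueN_prod R N (fun i (y : R) => heat1 t (tnth x i - y))).
- by under eq_bigr do rewrite integral_heat1//; rewrite big1.
- move=> i; apply: (measurableT_comp (measurable_heat1 _)).
  exact: measurable_funB.
- by move=> i y; rewrite heat1_ge0.
Qed.

Lemma gauss_semigroup a b x z : 0 < a -> 0 < b ->
  (\int[lebesgueN N]_y (gauss (vsub x y) a * gauss (vsub y z) b)%:E =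
   (gauss (vsub x z) (a + b))%:E)%E.
Proof.
move=> a0 b0.
under eq_integral => y _.
  rewrite !gauss_prod// -big_split/=.
  under eq_bigr do rewrite !tnth_vsub.
  over.
rewrite (@integral_lebesgueN_prod R N
  (fun i (y : R) => heat1 a (tnth x i - y) * heat1 b (y - tnth z i))).
- under eq_bigr do rewrite heat1_semigroup//.
  rewrite gauss_prod ?addr_gt0// prodEFin.
  by under eq_bigr do rewrite -tnth_vsub.
- move=> i; apply: measurable_funM; apply: (measurableT_comp (measurable_heat1 _)).
    exact: measurable_funB.
  exact: measurable_funB.
- by move=> i y; rewrite mulr_ge0 ?heat1_ge0.
Qed.

Lemma measurable_enorm : measurable_fun setT (@enorm R N).
Proof.
have mq : measurable_fun setT (@Num.sqrt R).
  by apply: continuous_measurable_fun; exact: sqrt_continuous.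
apply: (measurableT_comp mq).
apply: measurable_sum => i.
apply: measurable_funX; exact: measurable_tnth.
Qed.

Lemma measurable_powR_enorm (a : R) :
  measurable_fun setT (fun y : N.-tuple R => enorm y `^ a).
Proof. exact: (measurableT_comp (@measurable_powR R _) measurable_enorm). Qed.

Lemma enorm_ge0 x : 0 <= enorm x.
Proof. exact: sqrtr_ge0. Qed.

Lemma measurable_vsub d (T : measurableType d) (f g : T -> N.-tuple R) :
  measurable_fun setT f -> measurable_fun setT g ->
  measurable_fun setT (fun p => vsub (f p) (g p)).
Proof.
move=> mf mg; apply/measurable_fun_tnthP => i.
rewrite (_ : _ \o _ = fun p => tnth (f p) i - tnth (g p) i); last first.
  by apply/funext => p /=; rewrite tnth_vsub.
have mt := @measurable_tnth _ R N i.
by apply: measurable_funB; exact: (measurableT_comp mt).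
Qed.

Lemma measurable_gauss d (T : measurableType d) (f : T -> N.-tuple R) (s : T -> R) :
  measurable_fun setT f -> measurable_fun setT s ->
  measurable_fun setT (fun p => gauss (f p) (s p)).
Proof.
move=> mf ms; rewrite /gauss.
apply: measurable_funM.
  apply: (measurableT_comp (@measurable_powR R _)).
  exact: measurable_funM.
apply: measurableT_comp; first exact: measurable_expR.
apply: measurable_funN.
apply: measurable_funM.
  by apply: measurable_funX; exact: (measurableT_comp measurable_enorm).
apply: (measurableT_comp measurable_inv); exact: measurable_funM.
Qed.

End heat_kernel.

(** * Moments of the heat kernel and integrable power weights *)

Section moments.
Context {R : realType} (N : nat).
Implicit Types x y z : N.-tuple R.

Lemma abs_tnth_le_enorm x i : `|tnth x i| <= enorm x.
Proof.
rewrite -sqrtr_sqr ler_wsqrtr// (bigD1 i)//= lerDl.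
by apply: sumr_ge0 => j _; rewrite sqr_ge0.
Qed.

Lemma sqr_enorm_le x y : enorm y ^+ 2 <= 2 * enorm x ^+ 2 + 2 * enorm (vsub x y) ^+ 2.
Proof.
rewrite !sqr_enorm !mulr_sumr -big_split/=; apply: ler_sum => i _.
rewrite tnth_vsub -subr_ge0.
rewrite (_ : _ - _ = (2 * tnth x i - tnth y i) ^+ 2) ?sqr_ge0//; ring.
Qed.

(** From [ln w < w] at [w = z / (16 a)]. The rate [1 / 16] is chosen so that, in
    [heat_moment], the exponential is absorbed by the heat kernel. *)
Lemma powR_le_expR (a z : R) : 0 < a -> 0 <= z ->
  z `^ a <= (16 * a) `^ a * expR (z / 16).
Proof.
move=> a0; rewrite le_eqVlt => /predU1P[<-|z0].
  by rewrite powR0 ?gt_eqF// mulr_ge0 ?powR_ge0 ?expR_ge0.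
have a16 : 0 < 16 * a by rewrite mulr_gt0.
rewrite {1}(_ : z = (16 * a) * (z / (16 * a))); last by field; rewrite gt_eqF.
have z16 : 0 < z / (16 * a) by rewrite divr_gt0.
rewrite (powRM _ (ltW a16) (ltW z16)) ler_wpM2l ?powR_ge0//.
rewrite /powR gt_eqF// ler_expR.
rewrite (_ : z / 16 = a * (z / (16 * a))); last by field; rewrite gt_eqF.
by rewrite ler_wpM2l ?ltW// ln_sublinear.
Qed.

(** Half of the Gaussian decay can be spent on a growing exponential: what is
    left is a multiple of the kernel at time [2 t]. *)
Lemma gauss_expR x t : 0 < t ->
  gauss x t * expR (enorm x ^+ 2 / (8 * t)) =
  2 `^ (N%:R / 2) * gauss x (2 * t).
Proof.
move=> t0; rewrite /gauss -mulrA -expRD mulrA; congr (_ * expR _); last first.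
  by field; rewrite gt_eqF.
have p0 : 0 < 4 * pi * t :> R by rewrite mulr_gt0// mulr_gt0// pi_gt0.
rewrite (_ : 4 * pi * (2 * t) = 2 * (4 * pi * t)); last ring.
rewrite [in RHS](powRM _ _ (ltW p0))// mulrA -powRD; last by rewrite addrN eqxx pnatr_eq0.
by rewrite addrN powRr0 mul1r.
Qed.

(** The bound depends on [t] only, uniformly in the kernel time [s <= t] and in
    the center [x] of the parabolic region [|x|^2 <= t]: there
    [|y|^2 / t <= 2 + 2 |x - y|^2 / s], so that [(|y|^2 / t) ^ (k / 2)] is at
    most a multiple of [exp (|x - y|^2 / (8 s))]. *)
Lemma heat_moment (k : R) : 0 < k -> exists2 C : R, 0 < C &
  forall t s x, 0 < s -> s <= t -> enorm x ^+ 2 <= t ->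
  (\int[lebesgueN N]_y (gauss (vsub x y) s * enorm y `^ k)%:E <=
   (C * t `^ (k / 2))%:E)%E.
Proof.
move=> k0; have k2 : 0 < k / 2 by rewrite divr_gt0.
pose C := (16 * (k / 2)) `^ (k / 2) * expR (8^-1) * 2 `^ (N%:R / 2).
have C0 : 0 < C by rewrite !mulr_gt0 ?powR_gt0 ?expR_gt0// mulr_gt0.
exists C => // t s x s0 st xt; have t0 := lt_le_trans s0 st.
have mG (a : R) : measurable_fun setT (fun y => gauss (vsub x y) a).
  by apply: measurable_gauss => //; apply: measurable_vsub.
apply: (@le_trans _ _ (\int[lebesgueN N]_y
    ((C * t `^ (k / 2))%:E * (gauss (vsub x y) (2 * s))%:E))%E); last first.
  rewrite ge0_integralZl//.
  - by rewrite integral_gauss ?mule1// mulr_gt0.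
  - exact/measurable_EFinP.
  - by move=> y _; rewrite lee_fin gauss_ge0.
  - by rewrite lee_fin mulr_ge0 ?powR_ge0 ?ltW.
apply: ge0_le_integral => //.
- by move=> y _; rewrite lee_fin mulr_ge0 ?powR_ge0 ?gauss_ge0.
- apply/measurable_EFinP/measurable_funM => //.
  exact: measurable_powR_enorm.
- by apply/measurable_EFinP/measurable_funM.
move=> y _; rewrite -EFinM lee_fin.
have -> : enorm y `^ k = t `^ (k / 2) * (enorm y ^+ 2 / t) `^ (k / 2).
  have e0 : 0 <= enorm y ^+ 2 / t by rewrite divr_ge0 ?sqr_ge0// ltW.
  rewrite -(powRM _ (ltW t0) e0).
  rewrite (_ : t * _ = enorm y ^+ 2); last by field; rewrite gt_eqF.
  rewrite -powR_mulrn ?enorm_ge0// -powRrM; congr (_ `^ _); by field.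
rewrite mulrCA (mulrC C) -(mulrA (t `^ _) C) ler_wpM2l ?powR_ge0//.
rewrite /C -mulrA -gauss_expR// [leRHS]mulrCA ler_wpM2l ?gauss_ge0//.
apply: (le_trans (powR_le_expR k2 _)); first by rewrite divr_ge0 ?sqr_ge0 ?ltW.
rewrite -[leRHS]mulrA ler_wpM2l ?powR_ge0// -expRD ler_expR.
set d := enorm (vsub x y) ^+ 2 / (8 * s).
have d0 : 0 <= d by rewrite divr_ge0 ?sqr_ge0// mulr_ge0// ltW.
have ds : enorm (vsub x y) ^+ 2 = 8 * (d * s) by rewrite /d; field; rewrite gt_eqF.
have dt : d * s <= d * t by rewrite ler_wpM2l.
rewrite !ler_pdivrMr//; have := sqr_enorm_le x y; rewrite ds.
by nra.
Qed.

Lemma enorm_gt0 x i : tnth x i != 0 -> 0 < enorm x.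
Proof.
by move=> xi0; apply: lt_le_trans (abs_tnth_le_enorm x i); rewrite normr_gt0.
Qed.

Lemma measurable_box (A : 'I_N -> set R) : (forall i, measurable (A i)) ->
  measurable [set x : N.-tuple R | forall i, A i (tnth x i)].
Proof.
move=> mA; rewrite (_ : mkset _ = \bigcap_(i in [set: 'I_N])
    (fun x : N.-tuple R => tnth x i) @^-1` A i).
  apply: fin_bigcap_measurable => // i _.
  by rewrite -[X in measurable X]setTI; exact: (measurable_tnth i).
by apply/seteqP; split => x /= H i; [move=> _; apply: H|apply: H].
Qed.

Lemma ae_enorm_gt0 : (0 < N)%N -> {ae lebesgueN N, forall x : N.-tuple R, 0 < enorm x}.
Proof.
move=> N0; exists [set x | forall i, [set 0 : R] (tnth x i)]; split.
- exact: (@measurable_box (fun=> [set 0])).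
- rewrite (@lebesgueN_box R N (fun=> [set 0]))//.
  by rewrite (bigD1 (Ordinal N0))//= lebesgue_measure_set1 mul0e.
- move=> x /= x0 i; apply: contrapT => /eqP xi0; apply: x0.
  exact: enorm_gt0 xi0.
Qed.

Lemma measurable_eball y (rho : R) : measurable (eball y rho).
Proof.
rewrite /eball (_ : mkset _ = (fun x => enorm (vsub x y)) @^-1` `]-oo, rho[); last first.
  by apply/seteqP; split => x /=; rewrite in_itv.
rewrite -[X in measurable X]setTI.
apply: (measurableT_comp (@measurable_enorm R N)) => //.
by apply: measurable_vsub.
Qed.

(** A ball is contained in the cube with the same center whose half-side is the
    radius. The absolute value covers negative radii, for which the ball is
    empty. *)
Lemma lebesgueN_eball_le y (rho : R) :
  (lebesgueN N (eball y rho) <= ((2 * `|rho|) ^+ N)%:E)%E.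
Proof.
apply: (@le_trans _ _ (lebesgueN N
  [set x | forall i, `]tnth y i - `|rho|, tnth y i + `|rho|[%classic (tnth x i)])).
  apply: le_measure; rewrite ?inE; first exact: measurable_eball.
    by apply: (@measurable_box
      (fun i => `]tnth y i - `|rho|, tnth y i + `|rho|[%classic)).
  move=> x /= xy i; rewrite in_itv/= -ltr_distl -tnth_vsub.
  apply: le_lt_trans (abs_tnth_le_enorm _ _) (lt_le_trans xy _).
  exact: ler_norm.
rewrite (@lebesgueN_box R N (fun i => `]tnth y i - `|rho|, tnth y i + `|rho|[%classic))//.
rewrite -[X in (_ ^+ X)]card_ord -prodr_const -prodEFin.
rewrite le_eqVlt; apply/predU1P; left; apply: eq_bigr => i _.
rewrite lebesgue_measure_itv/= lte_fin.
case: ifPn => [_|]; first by rewrite -EFinB; congr EFin; ring.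
rewrite -leNgt => rho0; have -> : `|rho| = 0; last by rewrite mulr0.
by apply/eqP; rewrite eq_le normr_ge0 andbT; lra.
Qed.

Lemma enorm_vsub0 x : enorm (vsub x [tuple 0 | i < N]) = enorm x.
Proof.
congr enorm; apply/eq_from_tnth => i.
by rewrite tnth_vsub tnth_mktuple subr0.
Qed.

Lemma nneseries_geometric_le (a z : R) : 0 <= a -> 0 <= z -> z < 1 ->
  (\sum_(k <oo) (a * z ^+ k)%:E <= (a / (1 - z))%:E)%E.
Proof.
move=> a0 z0 z1; apply: lime_le.
  by apply: is_cvg_nneseries => n _ _; rewrite lee_fin mulr_ge0 ?exprn_ge0.
apply: nearW => n; rewrite sumEFin lee_fin big_mkord.
have := congr1 (fun u => u n) (@geometric_seriesE R a z (negbT (lt_eqF z1))).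
rewrite /series/= big_mkord => ->.
rewrite ler_wpM2r ?invr_ge0 ?subr_ge0 ?(ltW z1)//.
by rewrite ler_piMr// gerBl exprn_ge0.
Qed.

Section power_weight.
Variable b : R.
Hypotheses (b0 : 0 < b) (bN : b < N%:R).

(** A point with [2 ^ -(k+1) < |x| <= 2 ^ -k] has weight
    [|x| ^ -b <= 2 ^ (b (k+1))], so the weight is dominated near the origin by
    the series [dyadic], whose [k]-th integral is of order [2 ^ (k (b - N))]. The
    radius [2 / 2 ^ k] leaves a factor 2 so that open balls suffice. *)
Let B k := eball ([tuple 0 | i < N] : N.-tuple R) (2 / 2 ^+ k).

Let dyadic x : \bar R :=
  (\sum_(k <oo) ((2 `^ b) ^+ k.+1 * \1_(B k) x)%:E)%E.

Let measurable_dyadic_term k :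
  measurable_fun setT (fun x => ((2 `^ b) ^+ k.+1 * \1_(B k) x)%:E).
Proof.
apply/measurable_EFinP/measurable_funM => //.
by apply: measurable_indic; exact: measurable_eball.
Qed.

Let dyadic_term_ge0 k x : (0 <= ((2 `^ b) ^+ k.+1 * \1_(B k) x)%:E)%E.
Proof. by rewrite lee_fin mulr_ge0 ?exprn_ge0 ?powR_ge0. Qed.

Let powR_le_dyadic x : ((enorm x `^ (- b))%:E <= dyadic x + 1)%E.
Proof.
have S0 : (0 <= dyadic x)%E.
  by apply: nneseries_ge0 => k _ _; exact: dyadic_term_ge0.
have [x0|x0] := eqVneq (enorm x) 0.
  by rewrite x0 powR0 ?oppr_eq0 ?gt_eqF// adde_ge0.
have {}x0 : 0 < enorm x by rewrite lt_def x0 enorm_ge0.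
have [x1|x1] := leP 1 (enorm x).
  apply: (@le_trans _ _ 1%E); last by rewrite leeDr.
  rewrite lee_fin powRN invf_le1 ?powR_gt0//.
  by rewrite -(powRr0 (enorm x)) ler_powR// ltW.
have ex : exists k, enorm x > (2 ^+ k.+1)^-1.
  exists (Num.truncn (enorm x)^-1).
  rewrite -[ltRHS]invrK ltf_pV2 ?posrE ?invr_gt0 ?exprn_gt0//.
  apply: (@lt_le_trans _ _ ((Num.truncn (enorm x)^-1).+1%:R)).
    exact: truncnS_gt.
  by rewrite -natrX ler_nat ltnW// ltn_expl.
case: (ex_minnP ex) => k kx kmin.
have xk : enorm x < 2 / 2 ^+ k.
  case: k kx kmin => [_ _|k kx kmin]; first by rewrite expr0 divr1; lra.
  have := kmin k; rewrite ltnn; have [//|xk _] := ltP.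
    by move=> _ /(_ isT).
  apply: le_lt_trans xk _.
  by rewrite ltr_pMl ?invr_gt0 ?exprn_gt0// ltr1n.
apply: (@le_trans _ _ (dyadic x)); last by rewrite leeDl.
apply: le_trans (nneseries_lim_ge k.+1 _); last by move=> n _ _; exact: dyadic_term_ge0.
rewrite sumEFin lee_fin big_nat_recr//= ler_wpDl//.
  by apply: sumr_ge0 => i _; rewrite mulr_ge0 ?exprn_ge0 ?powR_ge0.
rewrite indicE mem_set ?mulr1; last by rewrite /B /eball/= enorm_vsub0.
rewrite -mulN1r powRrM powR_inv1 ?enorm_ge0//.
rewrite -powR_mulrn ?powR_ge0// powRAC powR_mulrn//.
apply: ge0_ler_powR; rewrite ?nnegrE ?invr_ge0 ?enorm_ge0 ?exprn_ge0 ?(ltW b0)//.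
by rewrite -[leRHS]invrK lef_pV2 ?posrE ?invr_gt0 ?exprn_gt0// ltW.
Qed.

Let measurable_weight := @measurable_powR_enorm R N (- b).

(** The constant [C] pays for the singularity, wherever the ball is; the other
    term is the volume of the ball, as the weight is at most 1 outside the unit
    ball. *)
Lemma integral_powR_enorm_le : exists2 C : R, 0 <= C & forall y rho,
  (\int[lebesgueN N]_(x in eball y rho) (enorm x `^ (- b))%:E <=
   (C + (2 * `|rho|) ^+ N)%:E)%E.
Proof.
have z0 : 0 <= 2 `^ b / 2 ^+ N :> R by rewrite divr_ge0 ?powR_ge0 ?exprn_ge0.
have z1 : 2 `^ b / 2 ^+ N < 1 :> R.
  rewrite ltr_pdivrMr ?exprn_gt0// mul1r -powR_mulrn// /powR gt_eqF//.
  by rewrite ltr_expR ltr_pM2r// ln_gt0// ltr1n.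
pose a : R := 2 `^ b * 4 ^+ N.
have a0 : 0 <= a by rewrite mulr_ge0 ?powR_ge0 ?exprn_ge0.
exists (a / (1 - 2 `^ b / 2 ^+ N)).
  by rewrite divr_ge0// subr_ge0 ltW.
move=> y rho; have mB := measurable_eball y rho.
apply: (@le_trans _ _ (\int[lebesgueN N]_(x in eball y rho) (dyadic x + 1))%E).
  apply: ge0_le_integral => //.
  - by move=> x _; rewrite lee_fin powR_ge0.
  - by apply/measurable_EFinP; exact: measurable_funTS.
  - apply: emeasurable_funD => //; apply: measurable_funTS.
    by apply: ge0_emeasurable_sum => //= k x _ _; exact: dyadic_term_ge0.
have dyadic_ge0 x : (0 <= dyadic x)%E.
  by apply: nneseries_ge0 => k _ _; exact: dyadic_term_ge0.
have mdyadic : measurable_fun setT dyadic.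
  by apply: ge0_emeasurable_sum => //= k x _ _; exact: dyadic_term_ge0.
rewrite ge0_integralD//; last exact: measurable_funTS.
rewrite EFinD leeD//; last first.
  by rewrite integral_cst// mul1e lebesgueN_eball_le.
apply: le_trans (nneseries_geometric_le a0 z0 z1).
apply: (@le_trans _ _ (\int[lebesgueN N]_x dyadic x)%E).
  exact: ge0_subset_integral.
rewrite integral_nneseries//.
apply: lee_nneseries.
  by move=> k _ _; apply: integral_ge0 => x _; exact: dyadic_term_ge0.
move=> k _.
under eq_integral do rewrite EFinM.
have mBk : measurable (B k) by exact: measurable_eball.
rewrite ge0_integralZl//; last by apply/measurable_EFinP; exact: measurable_indic.
rewrite integral_indic//.
rewrite setIT.
apply: (@le_trans _ _ (((2 `^ b) ^+ k.+1)%:E * ((2 * `|2 / 2 ^+ k|) ^+ N)%:E)%E).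
  by rewrite lee_wpmul2l ?lebesgueN_eball_le// lee_fin exprn_ge0 ?powR_ge0.
rewrite -EFinM lee_fin ger0_norm ?divr_ge0 ?exprn_ge0//.
rewrite mulrA (_ : 2 * 2 = 4 :> R); last ring.
rewrite exprMn [in leRHS]exprMn -!exprVn exprAC exprS /a.
by rewrite le_eqVlt; apply/predU1P; left; ring.
Qed.

(** The criterion by which both integrability claims on the initial datum are
    proved. *)
Lemma L1ul_of_le (phi : N.-tuple R -> R) (c d : R) :
  measurable_fun setT phi -> 0 <= c -> 0 <= d ->
  (forall x, `|phi x| <= c * enorm x `^ (- b) + d) -> L1ul phi.
Proof.
move=> mphi c0 d0 phi_le; have [C C0 hC] := integral_powR_enorm_le.
have bound y rho : (\int[lebesgueN N]_(x in eball y rho) `|phi x|%:E <=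
    (c * (C + (2 * `|rho|) ^+ N) + d * (2 * `|rho|) ^+ N)%:E)%E.
  have mB := measurable_eball y rho.
  apply: (@le_trans _ _ (\int[lebesgueN N]_(x in eball y rho)
      (c%:E * (enorm x `^ (- b))%:E + (cst d%:E) x))%E).
    apply: ge0_le_integral => //.
    - by apply/measurable_EFinP; apply: measurableT_comp => //; exact: measurable_funTS.
    - apply: emeasurable_funD => //; apply: measurable_funeM.
      by apply/measurable_EFinP; exact: measurable_funTS.
    - by move=> x _; rewrite -EFinM -EFinD lee_fin phi_le.
  rewrite ge0_integralD//; last 2 first.
  - by move=> x _; rewrite mule_ge0// lee_fin ?powR_ge0.
  - apply: measurable_funeM.
    by apply/measurable_EFinP; exact: measurable_funTS.
  rewrite EFinD leeD//.
    rewrite ge0_integralZl//; last 2 first.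
    - by apply/measurable_EFinP; exact: measurable_funTS.
    - by move=> x _; rewrite lee_fin powR_ge0.
    by rewrite EFinM lee_wpmul2l.
  by rewrite integral_cst// EFinM lee_wpmul2l// lebesgueN_eball_le.
split.
  split => // rho; apply: le_lt_trans (bound _ _) _; exact: ltry.
apply: (@le_lt_trans _ _ (c * (C + (2 * `|1|) ^+ N) + d * (2 * `|1|) ^+ N)%:E).
  by apply: ge_ereal_sup => _ [y _ <-]; exact: bound.
exact: ltry.
Qed.

End power_weight.
End moments.

(** * Calculus on the open half-line *)

Section half_line.
Context {R : realType}.
Implicit Types D d : R -> R.

Lemma MVT_pos D d a b : (forall x : R, 0 < x -> is_derive x 1 D (d x)) ->
  0 < a -> a <= b -> exists2 c, a <= c <= b & D b - D a = d c * (b - a).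
Proof.
move=> dD a0 ab.
have [||c] := @MVT_segment R D d a b ab.
- move=> x; rewrite in_itv/= => /andP[ax _]; apply: dD; exact: lt_trans ax.
- apply: derivable_within_continuous => x; rewrite in_itv/= => /andP[ax _].
  by have [] := dD x (lt_le_trans a0 ax).
- by rewrite in_itv/= => abc ?; exists c.
Qed.

Lemma tangent_le D d u m : (forall x : R, 0 < x -> is_derive x 1 D (d x)) ->
  (forall x y, 0 < x -> x <= y -> d x <= d y) -> 0 < u -> 0 < m ->
  D m + d m * (u - m) <= D u.
Proof.
move=> dD ndd u0 m0; have [um|/ltW mu] := leP u m.
  have [c /andP[uc cm] e] := MVT_pos dD u0 um.
  have := ndd c m (lt_le_trans u0 uc) cm; nra.
have [c /andP[mc cu] e] := MVT_pos dD m0 mu.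
have := ndd m c m0 mc; nra.
Qed.

(** At an interior point of the half-line the relative derivative is two-sided;
    Caratheodory's slope function turns the relative limit into a
    derivative. *)
Lemma is_derive_deriv_nneg D d (x : R) : deriv_nneg D d -> 0 < x -> is_derive x 1 D (d x).
Proof.
move=> dD x0; apply/is_derive1_caratheodory.
exists (fun z => if z == x then d x else (D z - D x) / (z - x)); split.
- move=> z; case: eqVneq => [->|zx]; first by rewrite !subrr mulr0.
  by rewrite divfK ?subr_eq0.
- apply/cvgrPdist_lt => e e0 /=; rewrite eqxx.
  have /cvgrPdist_lt/(_ e e0) := dD x (ltW x0).
  rewrite !near_withinE => H.
  apply: filterS2 H (lt_nbhsr x0) => z H z0.
  case: eqVneq => [_|zx]; first by rewrite subrr normr0.
  by apply: H => //; rewrite /= in_itv/= andbT ltW.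
- by rewrite eqxx.
Qed.

Lemma powRB1 (a b : R) : 0 < a -> a `^ b = a `^ (b - 1) * a.
Proof.
move=> a0; rewrite -[X in _ * X]powRr1 ?ltW// -powRD ?subrK//.
by rewrite (gt_eqF a0) implybT.
Qed.

(** The graph of [t ^ p] lies above its tangent at [h]: this is Young's
    inequality for [a] and [h ^ (p - 1)]. *)
Lemma powR_tangent (p a h : R) : 1 < p -> 0 <= a -> 0 <= h ->
  p * h `^ (p - 1) * a - (p - 1) * h `^ p <= a `^ p.
Proof.
move=> p1 a0 h0; have p0 : 0 < p := lt_trans ltr01 p1.
have p10 : 0 < p - 1 by rewrite subr_gt0.
have := @conjugate_powR R a (h `^ (p - 1)) p (p / (p - 1)) a0 (powR_ge0 _ _) p0.
rewrite divr_gt0// => /(_ isT).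
rewrite -powRrM (_ : (p - 1) * (p / (p - 1)) = p); last by field; rewrite gt_eqF.
have -> : p^-1 + (p / (p - 1))^-1 = 1.
  by field; rewrite !gt_eqF.
move=> /(_ erefl); rewrite invf_div.
have -> : a `^ p / p + h `^ p * ((p - 1) / p) = (a `^ p + (p - 1) * h `^ p) / p.
  by field; rewrite gt_eqF.
rewrite ler_pdivlMr// => H. rewrite lerBlDr (le_trans _ H)// le_eqVlt; apply/predU1P; left; ring.
Qed.

End half_line.

(** * The tail integral F(u) of 1 / f *)

Section tail_integral.
Context {R : realType}.
Variable f : R -> R.
Hypothesis f_gt0 : forall u : R, 0 < u -> 0 < f u.
Hypothesis df : forall u : R, 0 < u -> is_derive u 1 f (f^`()%classic u).
Hypothesis df_ge0 : forall u : R, 0 < u -> 0 <= f^`()%classic u.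
Hypothesis tail_fin : forall u : R, 0 < u -> (tail_int f u < +oo)%E.

Implicit Types a b m u x y : R.

Local Notation F := (fun u => fine (tail_int f u)).
Local Notation mu := (@lebesgue_measure R).

Lemma nondecreasing_pos x y : 0 < x -> x <= y -> f x <= f y.
Proof.
move=> x0 xy; have [c /andP[xc _] e] := MVT_pos df x0 xy.
by rewrite -subr_ge0 e mulr_ge0 ?subr_ge0// df_ge0// (lt_le_trans x0).
Qed.

Lemma continuous_inv_pos u : 0 < u -> {for u, continuous (fun t => (f t)^-1)}.
Proof.
move=> u0; apply: cvgV; first by rewrite gt_eqF ?f_gt0.
have [/derivable1_diffP/differentiable_continuous cf _] := df u0.
exact: cf.
Qed.

Lemma measurable_inv_pos (a : R) : 0 <= a ->
  measurable_fun `]a, +oo[ (fun t => ((f t)^-1)%:E).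
Proof.
move=> a0; apply/measurable_EFinP.
apply: open_continuous_measurable_fun; first exact: interval_open.
move=> u; rewrite inE/= in_itv/= andbT => au.
exact: continuous_inv_pos (le_lt_trans a0 au).
Qed.

Lemma tail_ge0 u : 0 < u -> (0 <= tail_int f u)%E.
Proof.
move=> u0; apply: integral_ge0 => t; rewrite /= in_itv/= andbT => ut.
by rewrite lee_fin invr_ge0 ltW// f_gt0// (lt_trans u0).
Qed.

Lemma tailK u : 0 < u -> (F u)%:E = tail_int f u.
Proof. by move=> u0; rewrite fineK// ge0_fin_numE ?tail_fin// tail_ge0. Qed.

Lemma integrable_inv_pos u : 0 < u ->
  mu.-integrable `]u, +oo[ (EFin \o (fun t => (f t)^-1)).
Proof.
move=> u0; apply/integrableP; split; first exact: measurable_inv_pos (ltW u0).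
apply: le_lt_trans (tail_fin u0); rewrite le_eqVlt; apply/predU1P; left.
apply: eq_integral => t; rewrite inE/= in_itv/= andbT => ut.
by rewrite ger0_norm// invr_ge0 ltW// f_gt0// (lt_trans u0).
Qed.

Lemma tail_split a b : 0 < a -> a <= b ->
  F b = F a - \int[mu]_(t in `]a, b]) (f t)^-1.
Proof.
move=> a0 ab; have b0 := lt_le_trans a0 ab.
have abU : `]a, +oo[%classic = `]a, b] `|` `]b, +oo[.
  apply/seteqP; split => t /=; rewrite !in_itv/= !andbT.
    by move=> ->; case: (leP t b) => ?; [left|right].
  by case=> [/andP[]//|]; exact: le_lt_trans.
have iab : mu.-integrable `]a, b] (EFin \o (fun t => (f t)^-1)).
  apply: integrableS (integrable_inv_pos a0) => //.
  by rewrite abU; exact: subsetUl.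
apply: EFin_inj; rewrite EFinB !tailK// /tail_int abU ge0_integral_setU//.
- rewrite /Rintegral fineK; last exact: integrable_fin_num.
  rewrite addeAC subee ?add0e//; exact: integrable_fin_num.
- by rewrite -abU; apply: measurable_inv_pos; exact: ltW.
- rewrite -abU => t /=; rewrite in_itv/= andbT => ut.
  by rewrite lee_fin invr_ge0 ltW// f_gt0// (lt_trans a0).
- apply/disj_setPS => t /= []; rewrite !in_itv/= andbT => /andP[_ tb] bt.
  by move: (le_lt_trans tb bt); rewrite ltxx.
Qed.

(** Near [u], [F] differs from a constant by the integral of [1 / f] from
    [u / 2], to which the fundamental theorem of calculus applies. *)
Lemma is_derive_tail u : 0 < u -> is_derive u 1 F (- (f u)^-1).
Proof.
move=> u0; have u2 : 0 < u / 2 by rewrite divr_gt0.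
have u2u : u / 2 < u by rewrite ltr_pdivrMr// ltr_pMr// ltr1n.
have uu1 : u < u + 1 by rewrite ltrDl.
have i : mu.-integrable `](u / 2), (u + 1)] (EFin \o (fun t => (f t)^-1)).
  apply: integrableS (integrable_inv_pos u2) => //.
  by apply: subset_itvl.
have [dG G'] := continuous_FTC1 uu1 i u2u (continuous_inv_pos u0).
have dGu : is_derive u 1 (fun x => \int[mu]_(t in `](u / 2), x]) (f t)^-1) (f u)^-1.
  by apply: DeriveDef => //; rewrite -derive1E.
apply: (@near_eq_is_derive _ _ _
  (cst (F (u / 2)) - (fun x => \int[mu]_(t in `](u / 2), x]) (f t)^-1))).
  by apply: filterS (lt_nbhsr u2u) => x ux; rewrite (tail_split u2 (ltW ux)).
by apply: is_derive_eq; rewrite sub0r.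
Qed.

Lemma tail_gt0 u : 0 < u -> 0 < F u.
Proof.
move=> u0; have uu1 : u <= u + 1 by rewrite lerDl.
have [c /andP[uc cu] e] := MVT_pos is_derive_tail u0 uu1.
have f0 : 0 < (f c)^-1 by rewrite invr_gt0 f_gt0// (lt_le_trans u0).
have : 0 <= F (u + 1) by rewrite fine_ge0// tail_ge0// (lt_le_trans u0).
by move: e => /=; nra.
Qed.

Lemma tail_nincr x y : 0 < x -> x <= y -> F y <= F x.
Proof.
move=> x0 xy; have [c /andP[xc _] e] := MVT_pos is_derive_tail x0 xy.
rewrite -subr_le0 e/= mulNr oppr_le0 mulr_ge0 ?subr_ge0// invr_ge0 ltW//.
by rewrite f_gt0// (lt_le_trans x0).
Qed.

Lemma tail_decr x y : 0 < x -> x < y -> F y < F x.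
Proof.
move=> x0 xy; have [c /andP[xc _] e] := MVT_pos is_derive_tail x0 (ltW xy).
rewrite -subr_lt0 e/= mulNr oppr_lt0 mulr_gt0 ?subr_gt0// invr_gt0.
by rewrite f_gt0// (lt_le_trans x0).
Qed.

(** [F] is convex, its derivative [- 1 / f] being nondecreasing. *)
Lemma tail_tangent u m : 0 < u -> 0 < m -> F m - (u - m) / f m <= F u.
Proof.
move=> u0 m0.
rewrite (_ : (u - m) / f m = - (- (f m)^-1 * (u - m))); last first.
  by rewrite mulNr opprK mulrC.
rewrite opprK.
apply: (@tangent_le R F (fun u => - (f u)^-1)) => //; first exact: is_derive_tail.
move=> x y x0 xy; rewrite lerN2 lef_pV2 ?posrE ?f_gt0// ?(lt_le_trans x0)//.
exact: nondecreasing_pos.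
Qed.

(** This is where the limit [q] of [f' F] enters: as [(f F)' = f' F - 1] tends to
    [q - 1 < s], [f F <= s u] for large [u], and then
    [(ln u + s ln F)' = 1 / u - s / (f F) <= 0]. So [u] is at most a multiple of
    [F(u) ^ -s], and in particular [F] tends to 0. *)
Lemma tail_growth (q s : R) : 0 < s -> q - 1 < s ->
  f^`()%classic xi * F xi @[xi --> +oo] --> q ->
  exists C : R, forall u, 1 <= u -> u * F u `^ s <= C.
Proof.
move=> s0 qs fq.
pose s1 := (q - 1 + s) / 2.
have s1s : s1 < s by rewrite /s1; lra.
have q1 : q < 1 + s1 by rewrite /s1; lra.
have [M [_ M1]] : \forall xi \near +oo, f^`()%classic xi * F xi <= 1 + s1.
  by apply: (cvgr_le _ fq).
pose a := Num.max 1 (M + 1).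
have a0 : 0 < a by rewrite lt_max ltr01.
have aM x : a <= x -> f^`()%classic x * F x <= 1 + s1.
  move=> ax; apply: M1; apply: lt_le_trans ax.
  by rewrite /a lt_max ltrDl ltr01 orbT.
(* [f F] grows at most linearly, with slope [s1]. *)
pose k x := f x * F x - s1 * x.
have dk x : 0 < x -> is_derive x 1 k (f^`()%classic x * F x - 1 - s1).
  move=> x0; have ? := is_derive_tail x0; have ? := df x0.
  rewrite /k.
  have -> : (fun x => f x * F x - s1 * x) = f * F - s1 \*: id by apply/funext.
  apply: is_derive_eq; rewrite /GRing.scale/= mulr1; congr (_ - _).
  by rewrite mulrN divff ?gt_eqF ?f_gt0// addrC mulrC.
have kle x : a <= x -> f x * F x <= s1 * x + k a.
  move=> ax; have [c /andP[ac _] e] := MVT_pos dk a0 ax.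
  suff : k x <= k a by rewrite {1}/k; lra.
  rewrite -subr_le0 e mulr_le0_ge0 ?subr_ge0//.
  by have := aM c ac; lra.
pose b := Num.max a (k a / (s - s1)).
have ab : a <= b by rewrite le_max lexx.
have b0 := lt_le_trans a0 ab.
have fF x : b <= x -> f x * F x <= s * x.
  move=> bx; have ax := le_trans ab bx; apply: le_trans (kle x ax) _.
  rewrite -lerBrDl -mulrBl -ler_pdivrMl ?subr_gt0// mulrC.
  by apply: le_trans bx; rewrite le_max lexx orbT.
(* [L] is the logarithm of [u F ^ s]. *)
pose L x := ln x + s * ln (F x).
have dL x : 0 < x -> is_derive x 1 L (x^-1 - s / (f x * F x)).
  move=> x0; have ? := is_derive_tail x0.
  have F0 := tail_gt0 x0; have ? := is_derive1_ln F0; have ? := is_derive1_ln x0.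
  rewrite /L.
  have -> : (fun x => ln x + s * ln (F x)) = @ln R + s \*: (@ln R \o F) by apply/funext.
  apply: is_derive_eq; rewrite /GRing.scale/=; congr (_ + _).
  by rewrite mulrN invfM mulrN [X in _ * X]mulrC.
have uF x : 0 < x -> x * F x `^ s = expR (L x).
  move=> x0; rewrite expRD lnK ?posrE//; congr (_ * _).
  by rewrite /powR gt_eqF// tail_gt0.
exists (b * F 1 `^ s).
have b1 : 1 <= b by rewrite (le_trans _ ab)// le_max lexx.
move=> u u1; have u0 : 0 < u := lt_le_trans ltr01 u1.
have powF x y : 0 < x -> x <= y -> F y `^ s <= F x `^ s.
  move=> x0 xy; have y0 := lt_le_trans x0 xy.
  apply: (ge0_ler_powR (ltW s0)); rewrite ?nnegrE.
  - exact: ltW (tail_gt0 y0).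
  - exact: ltW (tail_gt0 x0).
  - exact: tail_nincr.
have [ub|/ltW bu] := leP u b.
  exact: (ler_pM (ltW u0) (powR_ge0 _ _) ub (powF 1 u ltr01 u1)).
apply: (@le_trans _ _ (b * F b `^ s)); last first.
  exact: (ler_wpM2l (ltW b0) (powF 1 b ltr01 b1)).
rewrite (uF u u0) (uF b b0) ler_expR.
have [c /andP[bc _] e] := MVT_pos dL b0 bu.
rewrite -subr_le0 e mulr_le0_ge0 ?subr_ge0// subr_le0.
have c0 := lt_le_trans b0 bc.
have fFc : 0 < f c * F c by rewrite mulr_gt0 ?f_gt0 ?tail_gt0.
by rewrite ler_pdivlMr// mulrC ler_pdivrMr// fF.
Qed.

(** Intermediate values: by the growth bound, [F b <= z] as soon as
    [b >= C / z ^ s]. *)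
Lemma tail_inverse (C s z : R) : 0 < s ->
  (forall u, 1 <= u -> u * F u `^ s <= C) -> 0 < z -> z <= F 1 ->
  exists2 v, 1 <= v & F v = z.
Proof.
move=> s0 hC z0 z1.
pose b := Num.max 1 (C / z `^ s).
have b1 : 1 <= b by rewrite le_max lexx.
have b0 : 0 < b := lt_le_trans ltr01 b1.
have Fb : F b <= z.
  rewrite leNgt; apply/negP => zF.
  have zs : 0 < z `^ s by rewrite powR_gt0.
  have := hC b b1; apply/negP; rewrite -ltNge.
  apply: (@le_lt_trans _ _ (b * z `^ s)).
    by rewrite -ler_pdivrMr// le_max lexx orbT.
  by rewrite ltr_pM2l// gt0_ltr_powR ?nnegrE ?ltW// tail_gt0.
have cF : {within `[1, b], continuous F}.
  apply: derivable_within_continuous => x; rewrite in_itv/= => /andP[x1 _].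
  by have [] := is_derive_tail (lt_le_trans ltr01 x1).
have [|v] := @IVT R F 1 b z b1 cF; first by rewrite ge_min le_max z1 Fb orbT.
by rewrite in_itv/= => /andP[v1 _] Fv; exists v.
Qed.

End tail_integral.

(** * Convexity of a power of f *)

Section power_convexity.
Context {R : realType}.
Variables (f f1 f2 : R -> R) (delta : R).
Hypotheses (delta0 : 0 < delta) (delta1 : delta < 1).
Hypothesis f_gt0 : forall u : R, 0 < u -> 0 < f u.
Hypothesis df : forall u : R, 0 < u -> is_derive u 1 f (f1 u).
Hypothesis df1 : forall u : R, 0 < u -> is_derive u 1 f1 (f2 u).
Hypothesis ddf : forall u : R, 0 < u -> delta * f1 u ^+ 2 <= f u * f2 u.
Implicit Types u m x y z : R.

Let e : R := 1 - delta.

Let e0 : 0 < e. Proof. by rewrite subr_gt0. Qed.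

(** The condition [f f'' >= delta f'^2] says exactly that [f ^ (1 - delta)] is
    convex, the derivative of [f ^ (e - 1) f'] being
    [f ^ (e - 2) (f f'' - delta f'^2)] for [e = 1 - delta]. *)
Lemma power_tangent u m : 0 < u -> 0 < m ->
  f m `^ e + e * f m `^ (e - 1) * f1 m * (u - m) <= f u `^ e.
Proof.
move=> u0 m0.
have dpow (p x : R) : 0 < x ->
    is_derive x 1 (fun t => f t `^ p) (p * f x `^ (p - 1) * f1 x).
  move=> x0; have ? := df x0; have ? := is_derive1_powR p (f_gt0 x0).
  exact: (@is_derive1_comp _ (fun t => t `^ p) f).
pose d x := e * f x `^ (e - 1) * f1 x.
have dd x : 0 < x -> is_derive x 1 d
    (e * f x `^ (e - 1 - 1) * (f x * f2 x - delta * f1 x ^+ 2)).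
  move=> x0; have ? := dpow (e - 1) x x0; have ? := df1 x0.
  have -> : d = (e \*: (fun t => f t `^ (e - 1))) * f1 by apply/funext.
  apply: is_derive_eq; rewrite /GRing.scale/=.
  have -> : f x `^ (e - 1) = f x `^ (e - 1 - 1) * f x.
    by rewrite powRB1// f_gt0.
  rewrite -[e *: _]/(e * _) /e; ring.
apply: (tangent_le (D := fun t => f t `^ e) (d := d)) => //.
move=> x y x0 xy; have [c /andP[xc _] h] := MVT_pos dd x0 xy.
have c0 := lt_le_trans x0 xc.
by rewrite -subr_ge0 h mulr_ge0 ?subr_ge0// mulr_ge0 ?subr_ge0 ?ddf// mulr_ge0 ?powR_ge0 ?ltW.
Qed.

Let p : R := e^-1.

(** A tangent-line inequality for the weighted nonlinearity
    [z ^ -gamma * f u], which combines the convexity of [g = f ^ (1 / p)] with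
    that of [t ^ p]: bound [g u] below by its tangent at [m], and [(g u) ^ p] by
    the tangent at [h = l g(m)]. The choice [l = z ^ (gamma / (p - 1))] makes
    [z ^ -gamma * l ^ (p - 1) = 1], so that the coefficient of [u - m] does not
    depend on [z] and integrates to 0 against a probability of mean [m]. *)
Lemma weighted_tangent (gamma u m z : R) : 0 < gamma ->
  0 < u -> 0 < m -> 0 < z ->
  f m * (p - (p - 1) * z `^ (gamma / (p - 1))) + f1 m * (u - m) <=
  z `^ (- gamma) * f u.
Proof.
move=> g0 u0 m0 z0.
have e1 : e < 1 by rewrite /e gtrBl.
have p1 : 1 < p by rewrite invf_gt1.
have p10 : 0 < p - 1 by rewrite subr_gt0.
have fm := f_gt0 m0; have fu := f_gt0 u0.
pose k := gamma / (p - 1).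
pose l := z `^ k.
have l0 : 0 < l by rewrite powR_gt0.
have lg : l `^ (p - 1) = z `^ gamma.
  by rewrite -powRrM divfK// gt_eqF.
have lp : l `^ p = z `^ gamma * l.
  by rewrite -lg powRB1.
have zg : 0 < z `^ gamma by rewrite powR_gt0.
have := @powR_tangent R p (f u `^ e) (l * f m `^ e) p1 (powR_ge0 _ _)
  (mulr_ge0 (ltW l0) (powR_ge0 _ _)).
rewrite -[f u `^ e `^ p]powRrM divff ?gt_eqF// (powRr1 (ltW fu)).
have lfm (r : R) : (l * f m `^ e) `^ r = l `^ r * f m `^ (e * r).
  by rewrite powRM ?powR_ge0 ?(ltW l0)// powRrM.
rewrite !lfm lg lp divff ?gt_eqF// (powRr1 (ltW fm)).
have fe : f m `^ (e * (p - 1)) = (f m `^ (e - 1))^-1.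
  by rewrite -powRN; congr (_ `^ _); rewrite /p; field; rewrite gt_eqF.
have fe1 : f m `^ e = f m * f m `^ (e - 1).
  by rewrite mulrC powRB1.
have F0 : 0 < f m `^ (e - 1) by rewrite powR_gt0.
have T := power_tangent u0 m0; rewrite fe => H.
rewrite powRN ler_pdivlMl//.
apply: le_trans H.
set A := f m `^ (e - 1) in fe1 F0 T *.
have {}T : p * (z `^ gamma / A) * (f m * A + e * A * f1 m * (u - m)) <=
    p * (z `^ gamma / A) * f u `^ e.
  rewrite ler_wpM2l//; last by rewrite -fe1.
  by rewrite mulr_ge0 ?divr_ge0 ?ltW// (lt_trans _ p1).
apply: le_trans (lerB T (lexx _)).
rewrite le_eqVlt; apply/predU1P; left.
rewrite -/k -/l /p; field.
by rewrite !gt_eqF.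
Qed.

End power_convexity.

(** * Blow-up for an integral inequality *)

Section lifespan.
Context {R : realType}.
Variable f : R -> R.
Hypothesis f_gt0 : forall u : R, 0 < u -> 0 < f u.
Hypothesis df : forall u : R, 0 < u -> is_derive u 1 f (f^`()%classic u).
Hypothesis df_ge0 : forall u : R, 0 < u -> 0 <= f^`()%classic u.
Hypothesis tail_fin : forall u : R, 0 < u -> (tail_int f u < +oo)%E.
Local Notation mu := (@lebesgue_measure R).
Local Notation F := (fun u => fine (tail_int f u)).

Let continuous_f u : 0 < u -> {for u, continuous f}.
Proof. by move=> u0; apply/differentiable_continuous/derivable1_diffP; case: (df u0). Qed.

(** If [W(s) = w + int_0^s h] satisfies [W' >= K f(W)], then
    [(F(W))' <= - K], and [F > 0] bounds the time of existence by [F(w) / K].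
    As [h] is only measurable, the argument is run on
    [V = w + K int_0^s f(W) <= W], which is continuously differentiable with
    [V' = K f(W) >= K f(V)]. *)
Lemma lifespan_le (h : R -> \bar R) (t w K : R) :
  0 < t -> 0 < w -> 0 < K ->
  measurable_fun setT h -> (forall s, 0 <= h s)%E ->
  (\int[mu]_(s in `]0%R, t[) h s < +oo)%E ->
  {ae mu, forall s, 0 < s < t ->
    (K%:E * (f (w + fine (\int[mu]_(x in `]0%R, s[) h x)))%:E <= h s)%E} ->
  K * t <= F w.
Proof.
move=> t0 w0 K0 mh h0 hfin hK.
pose g s := fine (h s).
have g0 s : 0 <= g s by rewrite fine_ge0.
have gh s : ((g s)%:E <= h s)%E.
  by rewrite /g; case: (h s) (h0 s) => //= ; rewrite leey.
have mg : measurable_fun setT g.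
  exact: (measurableT_comp (@fine_measurable R setT measurableT) mh).
have mgD (D : set R) : measurable_fun D g by exact: measurable_funTS.
have mhD (D : set R) : measurable_fun D h by exact: measurable_funTS.
have ig : mu.-integrable `[0, t] (EFin \o g).
  apply/integrableP; split; first by apply/measurable_EFinP; exact: mgD.
  under eq_integral do rewrite /= ger0_norm//.
  rewrite integral_itv_bndoo; last by apply/measurable_EFinP; exact: mgD.
  apply: le_lt_trans hfin; apply: ge0_le_integral => //.
  - by move=> s _; rewrite lee_fin.
  - by apply/measurable_EFinP; exact: mgD.
  - exact: mhD.
pose G s := parameterized_integral mu 0 s g.
have G0 s : 0 <= G s by apply: Rintegral_ge0.
have cG : {within `[0, t], continuous G}.
  by apply: parameterized_integral_continuous => //; exact: ltW.
have cw s : 0 < w + G s by rewrite ltr_wpDr.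
(* The integral [G] is nonnegative at all [s], also outside [0, t], so that
   [w + G] and [V] stay where [f] and [F] are differentiable. *)
pose phi s := f (w + G s).
have phi0 s : 0 <= phi s by rewrite ltW// f_gt0.
have cphi : {within `[0, t], continuous phi}.
  apply: (@within_continuous_comp _ _ _ _ G (fun z => f (w + z))) => // x.
  rewrite inE => -[s _ <-].
  apply: (@continuous_comp _ _ _ (fun z => w + z) f); last exact: continuous_f.
  by apply: cvgD; [exact: cvg_cst|exact: cvg_id].
have iphi : mu.-integrable `[0, t] (EFin \o phi).
  by apply: continuous_compact_integrable => //; exact: segment_compact.
pose V s := w + K * parameterized_integral mu 0 s phi.
have cV : {within `[0, t], continuous V}.
  apply: (@within_continuous_comp _ _ _ _ _ (fun z => w + K * z)); last first.
    by apply: parameterized_integral_continuous => //; exact: ltW.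
  move=> x _; apply: cvgD; first exact: cvg_cst.
  by apply: cvgM; [exact: cvg_cst|exact: cvg_id].
have V0 s : 0 < V s.
  by rewrite ltr_wpDr// mulr_ge0 ?(ltW K0)//; apply: Rintegral_ge0.
have dV x : 0 < x < t -> is_derive x 1 V (K * phi x).
  move=> /andP[x0 xt].
  have [cphi_oo _ _] := (continuous_within_itvP phi t0).1 cphi.
  have cx : {for x, continuous phi} by apply: cphi_oo; rewrite in_itv/= x0.
  have [dP P'] := continuous_FTC1_closed xt iphi x0 cx.
  have ? : is_derive x 1 (fun y => parameterized_integral mu 0 y phi) (phi x).
    by apply: DeriveDef => //; rewrite -derive1E.
  rewrite /V (_ : (fun _ => _) =
    cst w + K \*: (fun y => parameterized_integral mu 0 y phi))//.
  by apply: is_derive_eq; rewrite add0r.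
have hfin_ae : {ae mu, forall s, `]0, t[%classic s -> h s \is a fin_num}.
  apply: integrable_ae => //.
  apply/integrableP; split; first exact: mhD.
  by under eq_integral do rewrite gee0_abs//.
have I_fin s : s <= t -> (\int[mu]_(x in `]0%R, s[) h x)%E \is a fin_num.
  move=> st; rewrite ge0_fin_numE ?integral_ge0//; apply: le_lt_trans hfin.
  by apply: ge0_subset_integral => //; [exact: mhD|apply: subset_itvl; rewrite bnd_simp].
have igs s : s <= t -> mu.-integrable `[0, s] (EFin \o g).
  by move=> st; apply: integrableS ig => //; apply: subset_itvl.
have iphis s : s <= t -> mu.-integrable `[0, s] (EFin \o phi).
  by move=> st; apply: integrableS iphi => //; apply: subset_itvl.
have GI s : s <= t -> G s <= fine (\int[mu]_(x in `]0%R, s[) h x)%E.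
  move=> st; apply: fine_le; [exact: integrable_fin_num (igs s st)|exact: I_fin|].
  rewrite integral_itv_bndoo; last by apply/measurable_EFinP; exact: mgD.
  apply: ge0_le_integral => //; last exact: mhD.
    by move=> x _; rewrite lee_fin.
  by apply/measurable_EFinP; exact: mgD.
have VG s : 0 < s < t -> V s <= w + G s.
  move=> /andP[s0 st]; rewrite lerD2l.
  have i1 := iphis s (ltW st); have i2 := igs s (ltW st).
  have i3 : mu.-integrable `[0, s] (EFin \o (fun x => K * phi x)).
    by apply: (integrableZl _ K i1).
  rewrite /parameterized_integral -RintegralZl//.
  apply: fine_le; [exact: integrable_fin_num i3|exact: integrable_fin_num i2|].
  have m1 : measurable_fun `]0, s[ (EFin \o (fun x => K * phi x)).
    have /integrableP[+ _] := i3; apply: measurable_funS => //.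
    exact: subset_itv_oo_cc.
  have m2 : measurable_fun `]0, s[ (EFin \o g) by apply/measurable_EFinP; exact: mgD.
  rewrite [leLHS]integral_itv_bndoo// [leRHS]integral_itv_bndoo//.
  apply: ae_ge0_le_integral => //.
  - by move=> x _; rewrite lee_fin mulr_ge0 ?(ltW K0).
  - by move=> x _; rewrite lee_fin.
  apply: (@filterS2 _ _ (ae_filter_ringOfSetsType mu) _ _ _ _ hK hfin_ae).
  move=> x hKx hx; rewrite /= in_itv/= => /andP[x0 xs].
  have xt := lt_trans xs st.
  have {}hx : h x \is a fin_num by apply: hx; rewrite /= in_itv/= x0.
  rewrite /g fineK//; apply: le_trans (hKx _); last by rewrite x0.
  rewrite lee_fin ler_wpM2l ?(ltW K0)//; apply: nondecreasing_pos (cw x) _ => //.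
  by rewrite lerD2l GI// ltW.
pose H s := F (V s) + K * s.
have dH x : 0 < x < t -> is_derive x 1 H (K * (1 - phi x / f (V x))).
  move=> xt; have ? := dV x xt.
  have ? := is_derive_tail f_gt0 df tail_fin (V0 x).
  have -> : H = (F \o V) + K \*: id by apply/funext.
  apply: is_derive_eq; rewrite /GRing.scale/=; ring.
have H_nincr : H t <= H 0.
  apply: (@ler0_derive1_nincr R H 0 t) => //.
  - by move=> x; rewrite in_itv/= => /dH[].
  - move=> x; rewrite in_itv/= => xt; rewrite derive1E; have [_ ->] := dH x xt.
    rewrite mulr_ge0_le0 ?(ltW K0)// subr_le0 ler_pdivlMr ?f_gt0// mul1r.
    exact: nondecreasing_pos (V0 x) (VG x xt).
  - move=> x; apply: cvgD; last first.
      by apply: cvgM; [exact: cvg_cst|apply: continuous_subspaceT => ?; exact: cvg_id].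
    apply: (@within_continuous_comp _ _ _ _ V F) => // {}x.
    rewrite inE => -[s _ <-].
      apply/differentiable_continuous/derivable1_diffP.
      by case: (is_derive_tail f_gt0 df tail_fin (V0 s)).
  - exact: ltW.
have V00 : V 0 = w.
  by rewrite /V /parameterized_integral set_itv1 Rintegral_set1 mulr0 addr0.
move: H_nincr; rewrite /H V00 mulr0 addr0; apply: le_trans.
by rewrite lerDr ltW//; apply: tail_gt0.
Qed.

End lifespan.

(** * The heat operator on nonnegative functions *)

Section heat_operator.
Context {R : realType} (N : nat).
Implicit Types (x y z : N.-tuple R) (phi psi : N.-tuple R -> R) (a b s t : R).

Lemma measurable_gauss_vsub x t : measurable_fun setT (fun y => gauss (vsub x y) t).
Proof. by apply: measurable_gauss => //; apply: measurable_vsub. Qed.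

Let measurable_heat_integrand x t phi : measurable_fun setT phi ->
  measurable_fun setT (fun y => (gauss (vsub x y) t * phi y)%:E).
Proof.
by move=> mphi; apply/measurable_EFinP/measurable_funM => //; exact: measurable_gauss_vsub.
Qed.

Lemma heat_ge0 t phi x : (forall y, 0 <= phi y) -> (0 <= heat t phi x)%E.
Proof. by move=> phi0; apply: integral_ge0 => y _; rewrite lee_fin mulr_ge0 ?gauss_ge0. Qed.

Lemma heatD t phi psi x :
  measurable_fun setT phi -> measurable_fun setT psi ->
  (forall y, 0 <= phi y) -> (forall y, 0 <= psi y) ->
  heat t (fun y => phi y + psi y) x = (heat t phi x + heat t psi x)%E.
Proof.
move=> mphi mpsi phi0 psi0; rewrite /heat -ge0_integralD//.
- by apply: eq_integral => y _; rewrite mulrDr EFinD.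
- by move=> y _; rewrite lee_fin mulr_ge0 ?gauss_ge0.
- exact: measurable_heat_integrand.
- by move=> y _; rewrite lee_fin mulr_ge0 ?gauss_ge0.
- exact: measurable_heat_integrand.
Qed.

Lemma heatZ t c phi x : measurable_fun setT phi -> (forall y, 0 <= phi y) -> 0 <= c ->
  heat t (fun y => c * phi y) x = (c%:E * heat t phi x)%E.
Proof.
move=> mphi phi0 c0; rewrite /heat -ge0_integralZl//.
- by apply: eq_integral => y _; rewrite mulrCA EFinM.
- exact: measurable_heat_integrand.
- by move=> y _; rewrite lee_fin mulr_ge0 ?gauss_ge0.
Qed.

Lemma heat_cst t c x : 0 < t -> 0 <= c -> heat t (fun=> c) x = c%:E.
Proof.
move=> t0 c0; rewrite /heat.
under eq_integral do rewrite mulrC EFinM.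
rewrite ge0_integralZl//.
- by rewrite integral_gauss// mule1.
- by apply/measurable_EFinP; exact: measurable_gauss_vsub.
- by move=> y _; rewrite lee_fin gauss_ge0.
Qed.

Lemma heat_le t phi psi x :
  measurable_fun setT phi -> measurable_fun setT psi ->
  (forall y, 0 <= phi y) -> (forall y, 0 <= psi y) ->
  {ae lebesgueN N, forall y, phi y <= psi y} -> (heat t phi x <= heat t psi x)%E.
Proof.
move=> mphi mpsi phi0 psi0 le; apply: ae_ge0_le_integral => //.
- by move=> y _; rewrite lee_fin mulr_ge0 ?gauss_ge0.
- exact: measurable_heat_integrand.
- by move=> y _; rewrite lee_fin mulr_ge0 ?gauss_ge0.
- exact: measurable_heat_integrand.
by apply: filterS le => y le _; rewrite lee_fin ler_wpM2l ?gauss_ge0.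
Qed.

Lemma heat_ge1 t phi x : 0 < t -> measurable_fun setT phi ->
  (forall y, 1 <= phi y) -> (1 <= heat t phi x)%E.
Proof.
move=> t0 mphi phi1; rewrite -(@heat_cst t 1 x)//.
by apply: heat_le => //; [move=> y; exact: le_trans (phi1 y)|exact: aeW].
Qed.

Lemma heat_semigroup a b phi x : 0 < a -> 0 < b ->
  measurable_fun setT phi -> (forall y, 0 <= phi y) ->
  (\int[lebesgueN N]_y ((gauss (vsub x y) a)%:E * heat b phi y) =
   heat (a + b) phi x)%E.
Proof.
move=> a0 b0 mphi phi0.
transitivity (\int[lebesgueN N]_y \int[lebesgueN N]_z
    (gauss (vsub x y) a * gauss (vsub y z) b * phi z)%:E)%E.
  apply: eq_integral => y _; rewrite /heat -ge0_integralZl//.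
  - by apply: eq_integral => z _; rewrite -EFinM mulrA.
  - exact: measurable_heat_integrand.
  - by move=> z _; rewrite lee_fin mulr_ge0 ?gauss_ge0.
  - by rewrite lee_fin gauss_ge0.
rewrite (@fubini_tonelli _ _ _ _ _ (lebesgueN N) (lebesgueN N)
  (fun p => (gauss (vsub x p.1) a * gauss (vsub p.1 p.2) b * phi p.2)%:E))/=; last 2 first.
- apply/measurable_EFinP; apply: measurable_funM.
    apply: measurable_funM; apply: measurable_gauss => //.
    - by apply: measurable_vsub.
    - by apply: measurable_vsub.
  exact: (measurableT_comp mphi).
- by move=> p; rewrite lee_fin mulr_ge0// mulr_ge0 ?gauss_ge0.
apply: eq_integral => z _.
under eq_integral do rewrite mulrC EFinM.
rewrite ge0_integralZl//.
- by rewrite gauss_semigroup// -EFinM mulrC.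
- apply/measurable_EFinP; apply: measurable_funM; apply: measurable_gauss => //;
    by apply: measurable_vsub.
- by move=> y _; rewrite lee_fin mulr_ge0 ?gauss_ge0.
- by rewrite lee_fin.
Qed.

End heat_operator.

(** * Jensen inequalities for the heat operator *)

Section jensen.
Context {R : realType} (N : nat).
Hypothesis N0 : (0 < N)%N.
Implicit Types (x y z : N.-tuple R) (a b c m s t : R).

Section weighted.
Variables (f f1 f2 : R -> R) (delta : R).
Hypotheses (delta0 : 0 < delta) (delta1 : delta < 1).
Hypothesis f_ge0 : forall u : R, 0 <= u -> 0 <= f u.
Hypothesis f_gt0 : forall u : R, 0 < u -> 0 < f u.
Hypothesis df : forall u : R, 0 < u -> is_derive u 1 f (f1 u).
Hypothesis df1 : forall u : R, 0 < u -> is_derive u 1 f1 (f2 u).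
Hypothesis f1_ge0 : forall u : R, 0 < u -> 0 <= f1 u.
Hypothesis ddf : forall u : R, 0 < u -> delta * f1 u ^+ 2 <= f u * f2 u.
Hypothesis mf : measurable_fun (`[0, +oo[%classic : set R) f.

Lemma measurable_comp_nneg d (T : measurableType d) (v : T -> R) :
  measurable_fun setT v -> (forall y : T, 0 <= v y) -> measurable_fun setT (f \o v).
Proof.
move=> mv v0; apply: (@measurable_comp _ _ _ _ _ _ (`[0, +oo[%classic : set R)) => //.
by move=> _ [y _ <-]; rewrite /= in_itv/= andbT.
Qed.

(** Integrate [weighted_tangent] at [z = |y| / rho] against the heat kernel. The
    moment of [|y| ^ k] is at most [rho ^ k] for the scale [rho], which is a
    multiple of [t ^ (1/2)]; the bracket [p - (p - 1) (|y| / rho) ^ k] then has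
    integral at least 1, and the constant is [rho ^ - gamma]. *)
Lemma heat_weighted_jensen (gamma : R) : 0 < gamma -> exists2 c : R, 0 < c &
  forall t s x (v : N.-tuple R -> R) m, 0 < s -> s <= t -> enorm x ^+ 2 <= t ->
  measurable_fun setT v -> (forall y, 0 <= v y) ->
  {ae lebesgueN N, forall y, 0 < v y} -> 0 < m -> heat s v x = m%:E ->
  ((c * t `^ (- (gamma / 2)) * f m)%:E <=
   heat s (fun y => enorm y `^ (- gamma) * f (v y))%R x)%E.
Proof.
move=> g0; pose p : R := (1 - delta)^-1.
have p1 : 1 < p by rewrite invf_gt1 ?subr_gt0// gtrBl.
have p10 : 0 < p - 1 by rewrite subr_gt0.
pose k := gamma / (p - 1).
have k0 : 0 < k by rewrite divr_gt0.
have [C C0 moment] := @heat_moment R N k k0.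
exists (C `^ (k^-1 * gamma))^-1; first by rewrite invr_gt0 powR_gt0.
move=> t s x v m s0 st xt mv v0 vpos m0 hm.
have t0 := lt_le_trans s0 st.
pose rho := C `^ k^-1 * t `^ (2^-1).
have rho0 : 0 < rho by rewrite mulr_gt0 ?powR_gt0.
have rhok : rho `^ k = C * t `^ (k / 2).
  rewrite powRM ?powR_ge0// -!powRrM mulVf ?gt_eqF// powRr1 ?ltW//.
  by congr (_ * _ `^ _); rewrite mulrC.
have rhokgt0 : 0 < rho `^ k by rewrite powR_gt0.
have rhog : rho `^ gamma = C `^ (k^-1 * gamma) * t `^ (gamma / 2).
  by rewrite powRM ?powR_ge0// -!powRrM; congr (_ * _ `^ _); rewrite mulrC.
pose B := (p - 1) * f m / rho `^ k.
have B0 : 0 <= B by rewrite divr_ge0 ?mulr_ge0 ?(ltW p10) ?(ltW (f_gt0 m0))// ltW.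
have fm0 := f_gt0 m0; have f1m0 := f1_ge0 m0.
have pfm0 : 0 <= p * f m by rewrite mulr_ge0 ?(ltW fm0)// (le_trans ler01) ?ltW.
have f1mm0 : 0 <= f1 m * m by rewrite mulr_ge0 ?(ltW m0).
have mfv : measurable_fun setT (f \o v) by exact: measurable_comp_nneg.
pose w y := enorm y `^ (- gamma) * f (v y).
have mw : measurable_fun setT w.
  by apply: measurable_funM => //; exact: measurable_powR_enorm.
have w0 y : 0 <= w y by rewrite mulr_ge0 ?powR_ge0 ?f_ge0.
have mk := @measurable_powR_enorm R N k.
have A0 : 0 <= rho `^ gamma by exact: powR_ge0.
(* The negative terms are moved to the other side, as the integrals are those of
   nonnegative extended-real functions. *)
have key : (heat s (fun y => p * f m + f1 m * v y)%R x <=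
    heat s (fun y => (rho `^ gamma * w y + B * enorm y `^ k) + f1 m * m)%R x)%E.
  apply: heat_le.
  - by apply: measurable_funD => //; exact: measurable_funM.
  - by apply: measurable_funD => //; apply: measurable_funD; exact: measurable_funM.
  - by move=> y; rewrite addr_ge0// mulr_ge0.
  - by move=> y; rewrite !addr_ge0// mulr_ge0 ?powR_ge0.
  apply: (@filterS2 _ _ (ae_filter_ringOfSetsType (lebesgueN N)) _ _ _ _ vpos
    (ae_enorm_gt0 N0)).
  move=> y vy y0.
  have yr : 0 < enorm y / rho by rewrite divr_gt0.
  have := weighted_tangent delta0 delta1 f_gt0 df df1 ddf g0 vy m0 yr.
  rewrite -/p -/k.
  have e (a : R) : (enorm y / rho) `^ a = enorm y `^ a / rho `^ a.
    rewrite powRM ?invr_ge0 ?(ltW rho0) ?(ltW y0)//.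
    by rewrite -(powR_inv1 (ltW rho0)) -powRrM mulN1r powRN.
  rewrite !e [X in _ / X * f _]powRN invrK.
  have -> : enorm y `^ (- gamma) * rho `^ gamma * f (v y) = rho `^ gamma * w y.
    by rewrite /w; ring.
  have -> : B * enorm y `^ k = f m * ((p - 1) * (enorm y `^ k / rho `^ k)).
    by rewrite /B; field; rewrite gt_eqF.
  by move=> H; lra.
have mB : measurable_fun setT (fun y : N.-tuple R => B * enorm y `^ k) by exact: measurable_funM.
have mA : measurable_fun setT (fun y : N.-tuple R => rho `^ gamma * w y) by exact: measurable_funM.
have mv1 : measurable_fun setT (fun y : N.-tuple R => f1 m * v y) by exact: measurable_funM.
move: key; rewrite heatD//; last by move=> y; rewrite mulr_ge0.
rewrite heat_cst// heatZ// hm.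
rewrite heatD//; [|exact: measurable_funD|by move=> y; rewrite addr_ge0// mulr_ge0 ?powR_ge0].
rewrite heat_cst// heatD//; last 2 first.
- by move=> y; rewrite mulr_ge0.
- by move=> y; rewrite mulr_ge0 ?powR_ge0.
rewrite !heatZ//; last by move=> y; exact: powR_ge0.
have := moment t s x s0 st xt; rewrite -/(heat s (fun y => enorm y `^ k) x) -rhok.
have := @heat_ge0 R N s (fun y => enorm y `^ k) x (fun y => powR_ge0 _ _).
case: (heat s (fun y => enorm y `^ k) x) => // M; rewrite !lee_fin => M0 Mle.
have := @heat_ge0 R N s w x w0.
rewrite -/(heat s w x) -/w; case: (heat s w x) => [h| |]//; last by move=> *; rewrite leey.
rewrite -!EFinM -!EFinD !lee_fin => h0 H.
have BM : B * M <= (p - 1) * f m.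
  rewrite /B mulrAC ler_pdivrMr// ler_wpM2l//.
  by rewrite mulr_ge0 ?(ltW p10) ?(ltW fm0).
rewrite powRN -invfM -rhog ler_pdivrMl ?powR_gt0//; lra.
Qed.

End weighted.
End jensen.

Section tail_jensen.
Context {R : realType} (N : nat).
Hypothesis N0 : (0 < N)%N.
Variable f : R -> R.
Hypothesis f_gt0 : forall u : R, 0 < u -> 0 < f u.
Hypothesis df : forall u : R, 0 < u -> is_derive u 1 f (f^`()%classic u).
Hypothesis df_ge0 : forall u : R, 0 < u -> 0 <= f^`()%classic u.
Hypothesis tail_fin : forall u : R, 0 < u -> (tail_int f u < +oo)%E.
Local Notation F := (fun u => fine (tail_int f u)).

(** Jensen's inequality for the convex function [F]: its value at the average of
    [v] is at most the average of [F(v) <= |y| ^ a]. *)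
Lemma tail_heat_le (a : R) : 0 < a -> exists2 C : R, 0 < C &
  forall t x (v : N.-tuple R -> R) w, 0 < t -> enorm x ^+ 2 <= t ->
  measurable_fun setT v -> (forall y, 1 <= v y) ->
  (forall y, 0 < enorm y -> F (v y) <= enorm y `^ a) ->
  heat t v x = w%:E -> F w <= C * t `^ (a / 2).
Proof.
move=> a0; have [C C0 moment] := @heat_moment R N a a0.
exists C => // t x v w t0 xt mv v1 Fv hw.
have w1 : 1 <= w by rewrite -lee_fin -hw heat_ge1.
have w0 : 0 < w := lt_le_trans ltr01 w1.
have fw : 0 < (f w)^-1 by rewrite invr_gt0 f_gt0.
have Fw := tail_gt0 f_gt0 df tail_fin w0.
have v0 y : 0 <= v y := le_trans ler01 (v1 y).
have mk := @measurable_powR_enorm R N a.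
have mv1 : measurable_fun setT (fun y : N.-tuple R => (f w)^-1 * v y) by exact: measurable_funM.
have : (heat t (fun=> F w + (f w)^-1 * w)%R x <=
    heat t (fun y => enorm y `^ a + (f w)^-1 * v y)%R x)%E.
  apply: heat_le => //.
  - exact: measurable_funD.
  - by move=> y; rewrite addr_ge0 ?mulr_ge0 ?ltW.
  - by move=> y; rewrite addr_ge0 ?mulr_ge0 ?powR_ge0 ?(ltW fw).
  apply: filterS (ae_enorm_gt0 N0) => y y0.
  have := tail_tangent f_gt0 df df_ge0 tail_fin (lt_le_trans ltr01 (v1 y)) w0.
  have := Fv y y0; lra.
rewrite heat_cst//; last by rewrite addr_ge0 ?mulr_ge0 ?ltW.
rewrite heatD//; last 2 first.
- by move=> y; rewrite powR_ge0.
- by move=> y; rewrite mulr_ge0 ?(ltW fw).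
rewrite heatZ ?(ltW fw)// hw.
have := moment t t x t0 (lexx _) xt; rewrite -/(heat t (fun y => enorm y `^ a) x).
have := @heat_ge0 R N t (fun y => enorm y `^ a) x (fun y => powR_ge0 _ _).
case: (heat t (fun y => enorm y `^ a) x) => // M; rewrite !lee_fin => M0 Mle.
by move=> H; apply: le_trans Mle; move: H; rewrite /=; lra.
Qed.

End tail_jensen.

(** * Sections of almost everywhere properties *)

Section almost_everywhere_sections.
Context d1 d2 (T1 : measurableType d1) (T2 : measurableType d2) (R : realType).
Variables (m1 : {sigma_finite_measure set T1 -> \bar R})
  (m2 : {sigma_finite_measure set T2 -> \bar R}).

Lemma ae_prod_sections (P : T1 * T2 -> Prop) :
  {ae (m1 \x m2)%E, forall p, P p} ->
  {ae m2, forall y, {ae m1, forall x, P (x, y)}}.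
Proof.
move=> [A [mA A0 PA]].
have mI : measurable_fun setT (fun p : T1 * T2 => (\1_A p)%:E : \bar R).
  by apply/measurable_EFinP; exact: measurable_indic.
have I0 (p : T1 * T2) : (0 <= (\1_A p)%:E :> \bar R)%E by rewrite lee_fin.
have mG := @measurable_fun_fubini_tonelli_G _ _ _ _ _ m1 _ mI I0.
have G0 y : (0 <= fubini_G m1 (fun p => (\1_A p)%:E) y)%E.
  by apply: integral_ge0.
have int0 : (\int[m2]_y fubini_G m1 (fun p => (\1_A p)%:E) y = 0)%E.
  rewrite -(@fubini_tonelli2 _ _ _ _ _ m1 m2 _ mI I0) integral_indic//.
  by rewrite setIT.
have : ae_eq m2 setT (fubini_G m1 (fun p => (\1_A p)%:E)) (cst 0%E).
  apply/ae_eq_integral_abs => //.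
  by under eq_integral do rewrite gee0_abs//.
apply: filterS => y /(_ I); rewrite /fubini_G/= => Ay0.
exists (ysection A y); split.
- exact: measurable_ysection.
- rewrite -Ay0; rewrite -[in LHS](setIT (ysection A y)) -integral_indic//.
    by apply: eq_integral => x _; rewrite !indicE mem_ysection.
  exact: measurable_ysection.
- by move=> x /= nP; apply/set_mem; rewrite mem_ysection; apply/mem_set/PA.
Qed.

Lemma ae_meets (P : T1 -> Prop) (A : set T1) :
  {ae m1, forall x, P x} -> measurable A -> (0 < m1 A)%E -> exists2 x, A x & P x.
Proof.
move=> [B [mB B0 PB]] mA; apply: contraPP => /forall2NP nP.
apply/negP; rewrite -leNgt -B0; apply: le_measure; rewrite ?inE// => x Ax.
by apply: PB => /= Px; case: (nP x).
Qed.

End almost_everywhere_sections.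

(** * The Duhamel formula at an intermediate time *)

Section duhamel_semigroup.
Context {R : realType} (N : nat).
Variable Phi : N.-tuple R -> R -> R.
Hypothesis mPhi : measurable_fun setT
  (fun p : N.-tuple R * measurableTypeR R => Phi p.1 p.2).
Hypothesis Phi0 : forall y s, 0 <= Phi y s.
Local Notation mu := (@lebesgue_measure R).

Lemma measurable_Phi_section s : measurable_fun setT (Phi ^~ s).
Proof. exact: (measurableT_comp mPhi (pair2_measurable s)). Qed.

Lemma measurable_heat_source t : measurable_fun setT
  (fun p : N.-tuple R * measurableTypeR R => heat (t - p.2) (Phi ^~ p.2) p.1).
Proof.
pose g (q : (N.-tuple R * measurableTypeR R) * N.-tuple R) : \bar R :=
  (gauss (vsub q.1.1 q.2) (t - q.1.2) * Phi q.2 q.1.2)%:E.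
have mg : measurable_fun setT g.
  apply/measurable_EFinP; apply: measurable_funM.
    apply: measurable_gauss.
      apply: measurable_vsub => //.
      exact: (measurableT_comp (@measurable_fst _ _ _ _)).
    apply: measurable_funB => //.
    exact: (measurableT_comp (@measurable_snd _ _ _ _)).
  have mq : measurable_fun setT (fun q : (N.-tuple R * measurableTypeR R) * N.-tuple R =>
      (q.2, q.1.2)).
    apply: measurable_fun_pair => //.
    exact: (measurableT_comp (@measurable_snd _ _ _ _)).
  exact: (measurableT_comp mPhi mq).
have g0 q : (0 <= g q)%E by rewrite lee_fin mulr_ge0 ?gauss_ge0.
exact: (@measurable_fun_fubini_tonelli_F _ _ _ _ _ (lebesgueN N) g mg g0).
Qed.

Lemma measurable_heat_source_time t x : measurable_fun setT
  (fun s : measurableTypeR R => heat (t - s) (Phi ^~ s) x).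
Proof. exact: (measurableT_comp (measurable_heat_source t) (pair1_measurable x)). Qed.

Lemma measurable_heat_space t (v : N.-tuple R -> R) : measurable_fun setT v ->
  (forall y, 0 <= v y) -> measurable_fun setT (heat t v).
Proof.
move=> mv v0.
apply: (@measurable_fun_fubini_tonelli_F _ _ _ _ _ (lebesgueN N)
  (fun p => (gauss (vsub p.1 p.2) t * v p.2)%:E)).
  apply/measurable_EFinP; apply: measurable_funM.
    by apply: measurable_gauss => //; apply: measurable_vsub.
  exact: (measurableT_comp mv).
by move=> p; rewrite lee_fin mulr_ge0 ?gauss_ge0.
Qed.

(** Apply the heat operator over the remaining time [t - tau] to the Duhamel
    formula at time [tau]. By Tonelli and the semigroup property, only the upper
    bound of the time integral remembers [tau]. *)
Lemma heat_duhamel (u0 v : N.-tuple R -> R) (t tau : R) x :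
  0 < tau -> tau < t ->
  measurable_fun setT u0 -> (forall y, 0 <= u0 y) ->
  measurable_fun setT v -> (forall y, 0 <= v y) ->
  {ae lebesgueN N, forall y, (v y)%:E =
    (heat tau u0 y + \int[mu]_(s in `]0%R, tau[) heat (tau - s) (Phi ^~ s) y)%E} ->
  (heat (t - tau) v x = heat t u0 x +
    \int[mu]_(s in `]0%R, tau[) heat (t - s) (Phi ^~ s) x)%E.
Proof.
move=> tau0 taut mu0 u00 mv v0 hv.
have ttau0 : 0 < t - tau by rewrite subr_gt0.
pose G y : \bar R := (gauss (vsub x y) (t - tau))%:E.
have G0 y : (0 <= G y)%E by rewrite lee_fin gauss_ge0.
have mG : measurable_fun setT G.
  by apply/measurable_EFinP; exact: measurable_gauss_vsub.
pose D : set (measurableTypeR R) := `]0, tau[%classic.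
have mD : measurable D by exact: measurable_itv.
pose h y : \bar R := (\int[mu]_(s in D) heat (tau - s) (Phi ^~ s) y)%E.
have hs0 y s : (0 <= heat (tau - s) (Phi ^~ s) y)%E by exact: heat_ge0.
have h0 y : (0 <= h y)%E by apply: integral_ge0.
pose k (p : N.-tuple R * measurableTypeR R) : \bar R :=
  ((fun p => heat (tau - p.2)%R (Phi ^~ p.2) p.1) \_ (setT `*` D)) p.
have mk : measurable_fun setT k.
  apply/(measurable_restrictT _ _).1; first exact: measurableX.
  exact: measurable_funTS (measurable_heat_source tau).
have k0 p : (0 <= k p)%E by rewrite /k patchE; case: ifPn.
have hk y : h y = (\int[mu]_s k (y, s))%E.
  rewrite /h integral_mkcond; apply: eq_integral => s _.
  rewrite /k !patchE/=; congr (if _ then _ else _).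
  by apply/idP/idP; rewrite !inE /=; tauto.
have mh : measurable_fun setT h.
  rewrite (_ : h = fubini_F mu k); last by apply/funext => y; rewrite hk.
  exact: measurable_fun_fubini_tonelli_F.
have mheat := @measurable_heat_space tau u0 mu0 u00.
transitivity (\int[lebesgueN N]_y (G y * (heat tau u0 y + h y)))%E.
  apply: ge0_ae_eq_integral => //.
  - by apply/measurable_EFinP/measurable_funM => //; exact: measurable_gauss_vsub.
  - by apply: emeasurable_funM => //; exact: emeasurable_funD.
  - by move=> y _; rewrite lee_fin mulr_ge0 ?gauss_ge0.
  - by move=> y _; rewrite mule_ge0// adde_ge0// heat_ge0.
  - by apply: filterS hv => y hv _; rewrite EFinM hv.
under eq_integral.
  by move=> y _; rewrite ge0_muleDr ?heat_ge0//; over.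
rewrite ge0_integralD//; last 4 first.
- by move=> y _; rewrite mule_ge0// heat_ge0.
- exact: emeasurable_funM.
- by move=> y _; rewrite mule_ge0.
- exact: emeasurable_funM.
congr (_ + _)%E; first by rewrite heat_semigroup// subrK.
transitivity (\int[lebesgueN N]_y \int[mu]_s (G y * k (y, s)))%E.
  apply: eq_integral => y _; rewrite hk ge0_integralZl//.
  exact: (measurableT_comp mk (pair1_measurable y)).
rewrite (@fubini_tonelli _ _ _ _ _ (lebesgueN N) mu (fun p => G p.1 * k p)%E)/=; last 2 first.
- by apply: emeasurable_funM => //; exact: (measurableT_comp mG).
- by move=> p; rewrite mule_ge0.
rewrite [RHS]integral_mkcond; apply: eq_integral => s _.
rewrite patchE; case: ifPn => [|sD]; last first.
  apply: integral0_eq => y _; rewrite /k patchE ifF ?mule0//.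
  by apply/negbTE; move: sD; apply: contra; rewrite !inE => -[].
rewrite inE/= => sD.
have sD' := sD; move: sD'; rewrite /D/= in_itv/= => /andP[s0 stau].
under eq_integral.
  move=> y _; rewrite /k patchE mem_set//=; over.
have taus : 0 < tau - s by rewrite subr_gt0.
have -> : t - s = (t - tau) + (tau - s) by rewrite addrA subrK.
exact: (heat_semigroup x ttau0 taus (measurable_Phi_section s) (fun y => Phi0 y s)).
Qed.

End duhamel_semigroup.

(** * A necessary condition for local solvability *)

Section necessary_condition.
Context {R : realType} (N : nat).
Hypothesis N0 : (0 < N)%N.
Variables (f f2 : R -> R) (delta gamma : R).
Hypotheses (delta0 : 0 < delta) (delta1 : delta < 1) (gamma0 : 0 < gamma).
Hypothesis f_ge0 : forall u : R, 0 <= u -> 0 <= f u.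
Hypothesis f_gt0 : forall u : R, 0 < u -> 0 < f u.
Hypothesis df : forall u : R, 0 < u -> is_derive u 1 f (f^`()%classic u).
Hypothesis df1 : forall u : R, 0 < u -> is_derive u 1 f^`()%classic (f2 u).
Hypothesis df_ge0 : forall u : R, 0 < u -> 0 <= f^`()%classic u.
Hypothesis ddf : forall u : R, 0 < u -> delta * f^`()%classic u ^+ 2 <= f u * f2 u.
Hypothesis mf : measurable_fun (`[0, +oo[%classic : set R) f.
Hypothesis tail_fin : forall u : R, 0 < u -> (tail_int f u < +oo)%E.
Local Notation F := (fun u => fine (tail_int f u)).
Local Notation mu := (@lebesgue_measure R).

(** For a good point [(x, t)] put [W(s) = heat (t - s) (u(s)) x]. By
    [heat_duhamel], [W] is the integral of the source term, bounded by [u(x, t)],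
    and by [heat_weighted_jensen] its derivative is at least
    [c t ^ (- gamma / 2) f(W)]. So [lifespan_le] bounds [t] in terms of
    [W(0) = heat t u0 x]. *)
Lemma local_solution_lifespan : exists2 c : R, 0 < c &
  forall (u0 : N.-tuple R -> R) T u, measurable_fun setT u0 -> (forall y, 1 <= u0 y) ->
  local_solution gamma f u0 T u ->
  {ae mu, forall t, 0 < t < T -> {ae lebesgueN N, forall x, enorm x ^+ 2 <= t ->
    exists2 w, heat t u0 x = w%:E & c * t `^ (1 - gamma / 2) <= F w}}.
Proof.
have [c c0 jensen] := heat_weighted_jensen N0 delta0 delta1 f_ge0 f_gt0 df df1 df_ge0
  ddf mf gamma0.
exists c => // u0 T u mu0 u01 [mu_ u_ge0 _ _ formula].
(* The solution, extended by 0 to all times so as to be measurable on the whole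
   product. *)
pose D : set (N.-tuple R * measurableTypeR R) := setT `*` `]0, T[.
pose v (p : N.-tuple R * measurableTypeR R) : R := ((fun p => u p.1 p.2) \_ D) p.
have mD : measurable D by apply: measurableX.
have mv : measurable_fun setT v by apply/(measurable_restrictT _ _).1.
have v0 p : 0 <= v p.
  rewrite /v patchE; case: ifPn => //; rewrite inE => -[_ /=].
  by rewrite in_itv/=; exact: u_ge0.
have vE y s : 0 < s < T -> v (y, s) = u y s.
  by move=> sT; rewrite /v patchE mem_set//; split => //=; rewrite in_itv.
pose Phi (y : N.-tuple R) (s : R) := enorm y `^ (- gamma) * f (v (y, s)).
have Phi0 y s : 0 <= Phi y s by rewrite mulr_ge0 ?powR_ge0 ?f_ge0.
have mPhi : measurable_fun setT (fun p : N.-tuple R * measurableTypeR R => Phi p.1 p.2).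
  apply: measurable_funM.
    exact: (measurableT_comp (@measurable_powR_enorm R N (- gamma))).
  rewrite (_ : (fun _ => _) = f \o v); last by apply/funext => -[].
  exact: measurable_comp_nneg.
have duhamelE x t : 0 < t < T -> duhamel gamma f u x t =
    (\int[mu]_(s in `]0%R, t[) heat (t - s) (Phi ^~ s) x)%E.
  move=> /andP[t0 tT]; apply: eq_integral => s.
  rewrite inE/= in_itv/= => /andP[s0 st]; congr heat; apply/funext => y.
  by rewrite /Phi vE// s0 (lt_trans st).
have u00 y : 0 <= u0 y := le_trans ler01 (u01 y).
have mvs (s : R) : measurable_fun setT (fun y => v (y, s)).
  exact: (measurableT_comp mv (pair2_measurable s)).
have sections := ae_prod_sections formula.
apply: filterS (sections) => t tgood tT; have /andP[t0 tltT] := tT.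
apply: filterS tgood => x /(_ tT)/= + xt.
rewrite duhamelE//.
have hu0 := @heat_ge0 R N t u0 x u00.
pose h (s : R) := heat (t - s) (Phi ^~ s) x.
have h0 s : (0 <= h s)%E by exact: heat_ge0.
rewrite -/(h _) => hux.
have hfin : (\int[mu]_(s in `]0%R, t[) h s < +oo)%E.
  apply: (@le_lt_trans _ _ (u x t)%:E); last exact: ltry.
  by rewrite hux leeDr.
have [w hw] : exists w, heat t u0 x = w%:E.
  exists (fine (heat t u0 x)); rewrite fineK// ge0_fin_numE//.
  apply: (@le_lt_trans _ _ (u x t)%:E); last exact: ltry.
  by rewrite hux leeDl//; apply: integral_ge0 => s _; exact: h0.
exists w => //.
have w1 : 1 <= w by have := heat_ge1 x t0 mu0 u01; rewrite hw lee_fin.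
have w0 := lt_le_trans ltr01 w1.
have -> : c * t `^ (1 - gamma / 2) = c * t `^ (- (gamma / 2)) * t.
  by rewrite -mulrA (powRB1 _ t0); congr (_ * (_ `^ _ * _)); ring.
apply: (lifespan_le f_gt0 df df_ge0 tail_fin t0 w0 _ (h := h)) => //.
- by rewrite mulr_gt0// powR_gt0.
- exact: (measurable_heat_source_time mPhi Phi0 t x).
apply: filterS sections => s sgood /andP[s0 st].
have sT : 0 < s < T by rewrite s0 (lt_trans st).
have {}sgood : {ae lebesgueN N, forall y, (v (y, s))%:E =
    (heat s u0 y + \int[mu]_(x in `]0%R, s[) heat (s - x) (Phi ^~ x) y)%E}.
  apply: filterS sgood => y /(_ sT) /=.
  by rewrite (duhamelE _ _ sT) (vE _ _ sT); exact.
have Is0 : (0 <= \int[mu]_(x in `]0%R, s[) h x)%E by apply: integral_ge0.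
have Isfin : (\int[mu]_(x in `]0%R, s[) h x)%E \is a fin_num.
  rewrite ge0_fin_numE//; apply: le_lt_trans hfin.
  apply: ge0_subset_integral => //; last by apply: subset_itvl; rewrite bnd_simp ltW.
  exact: measurable_funTS (measurable_heat_source_time mPhi Phi0 t x).
have := heat_duhamel mPhi Phi0 x s0 st mu0 u00 (mvs s) (fun y => v0 _) sgood.
rewrite hw -/(h _) -[X in (_ + X)%E]fineK// -EFinD => hv.
rewrite -EFinM.
apply: jensen hv => //.
- by rewrite subr_gt0.
- by rewrite gerBl ltW.
- apply: filterS sgood => y hy; rewrite -lte_fin hy.
  apply: (@lt_le_trans _ _ 1%E) => //.
  apply: (@le_trans _ _ (heat s u0 y)); first exact: heat_ge1.
  by apply: leeDl; apply: integral_ge0 => z _; exact: heat_ge0.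
by rewrite ltr_wpDr// fine_ge0.
Qed.

End necessary_condition.

(** * Regularity of f up to the origin *)

Section regularity.
Context {R : realType}.
Variable f : R -> R.

Lemma is_derive2_C2_nneg : C2_nneg f ->
  forall u : R, 0 < u -> is_derive u 1 f^`()%classic (f^`(2)%classic u).
Proof.
move=> [g [h [fg gh _]]] u u0.
have f'g (v : R) : 0 < v -> f^`()%classic v = g v.
  by move=> v0; rewrite derive1E; have [_ ->] := is_derive_deriv_nneg fg v0.
have H : is_derive u 1 f^`()%classic (h u).
  apply: (@near_eq_is_derive _ _ _ g); last exact: is_derive_deriv_nneg gh u0.
  by apply: filterS (lt_nbhsr u0) => v v0; rewrite f'g.
suff -> : f^`(2)%classic u = h u by [].
by rewrite derive1nS derive1E; have [_ ->] := H.
Qed.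

Hypothesis cf : {within `[0, +oo[, continuous f}.

Lemma continuous_nneg_ge0 : (forall u : R, 0 < u -> 0 < f u) ->
  forall u : R, 0 <= u -> 0 <= f u.
Proof.
move=> f_gt0 u; rewrite le_eqVlt => /predU1P[<-|/f_gt0/ltW//].
have [_ f0] := (continuous_within_itvcyP 0 f).1 cf.
apply: (cvgr_to_ge f0).
by near=> v; apply/ltW/f_gt0; near: v; exact: nbhs_right_gt.
Unshelve. all: by end_near. Qed.

End regularity.

(** * The singular initial datum *)

Section singular_datum.
Context {R : realType} (N : nat).
Variable f : R -> R.
Hypothesis f_gt0 : forall u : R, 0 < u -> 0 < f u.
Hypothesis df : forall u : R, 0 < u -> is_derive u 1 f (f^`()%classic u).
Hypothesis tail_fin : forall u : R, 0 < u -> (tail_int f u < +oo)%E.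
Local Notation F := (fun u => fine (tail_int f u)).
Variables (a s C : R).
Hypotheses (a0 : 0 < a) (s0 : 0 < s).
Hypothesis growth : forall u : R, 1 <= u -> u * F u `^ s <= C.
Implicit Types x : N.-tuple R.

(** The function [F^-1 (min (|x| ^ a) (F 1))]. The truncation keeps it at least 1,
    away from the possible zero of [f] at 0; at the origin, where no value is
    admissible, the default value 1 is taken. *)
Definition singular_datum x : R :=
  xget 1 [set v | 1 <= v /\ F v = Num.min (enorm x `^ a) (F 1)].

Let F1 : 0 < F 1. Proof. exact: tail_gt0. Qed.

Lemma tail_singular_datum x : 0 < enorm x ->
  F (singular_datum x) = Num.min (enorm x `^ a) (F 1).
Proof.
move=> x0; have [||v v1 Fv] := @tail_inverse R f f_gt0 df tail_fin C s
  (Num.min (enorm x `^ a) (F 1)) s0 growth.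
- by rewrite lt_min powR_gt0.
- by rewrite ge_min lexx orbT.
by rewrite /singular_datum; case: xgetP => [y _ []//|/(_ v)[]].
Qed.

Lemma singular_datum_ge1 x : 1 <= singular_datum x.
Proof. by rewrite /singular_datum; case: xgetP => // y _ []. Qed.

Lemma singular_datum0 x : enorm x = 0 -> singular_datum x = 1.
Proof.
move=> x0; rewrite /singular_datum; case: xgetP => // y _ [y1].
rewrite x0 powR0 ?gt_eqF// min_l ?ltW// => Fy.
by have := tail_gt0 f_gt0 df tail_fin (lt_le_trans ltr01 y1); rewrite Fy ltxx.
Qed.

(** As [F] is decreasing, the superlevel sets of the datum are sublevel sets of
    [min (|x| ^ a) (F 1)], from which the origin is removed. *)
Lemma measurable_singular_datum : measurable_fun setT singular_datum.
Proof.
apply: (measurability _ (RGenOInfty.measurableE R)) => //.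
move=> _ [_ [c ->] <-]; rewrite setTI.
have [c1|c1] := ltP c 1.
  rewrite (_ : _ @^-1` _ = setT)//; apply/seteqP; split => x //= _.
  by rewrite in_itv/= andbT (lt_le_trans c1)// singular_datum_ge1.
have c0 : 0 < c := lt_le_trans ltr01 c1.
rewrite (_ : _ @^-1` _ = (@enorm R N @^-1` `]0, +oo[) `&`
    ((fun x => Num.min (enorm x `^ a) (F 1)) @^-1` `]-oo, F c[)).
  have mpre (g : N.-tuple R -> R) (A : set R) : measurable_fun setT g ->
      measurable A -> measurable (g @^-1` A).
    by move=> mg mA; rewrite -[X in measurable X]setTI; exact: mg.
  apply: measurableI; apply: mpre => //; first exact: measurable_enorm.
  apply: measurable_minr => //; exact: measurable_powR_enorm.
apply/seteqP; split => x /=; rewrite !in_itv/= ?andbT.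
  move=> cx; have x0 : 0 < enorm x.
    rewrite lt_def enorm_ge0 andbT; apply/eqP => x0.
    by move: cx; rewrite singular_datum0// ltNge c1.
  by rewrite x0 -tail_singular_datum//; split => //; exact: tail_decr.
move=> [x0]; rewrite -tail_singular_datum// => Fx.
rewrite ltNge; apply/negP => xc; move: Fx; apply/negP; rewrite -leNgt.
apply: tail_nincr => //; exact: lt_le_trans ltr01 (singular_datum_ge1 x).
Qed.

Lemma tail_singular_datum_powRN (e : R) x : 0 < e ->
  F (singular_datum x) `^ (- e) <= enorm x `^ (- (a * e)) + F 1 `^ (- e).
Proof.
move=> e0; have [x0|x0] := eqVneq (enorm x) 0.
  by rewrite singular_datum0// lerDr powR_ge0.
have {}x0 : 0 < enorm x by rewrite lt_def x0 enorm_ge0.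
rewrite tail_singular_datum// minEle; case: ifPn => _.
  by rewrite -powRrM mulrN lerDl powR_ge0.
by rewrite lerDr powR_ge0.
Qed.

Lemma singular_datum_le x :
  singular_datum x <= C * (enorm x `^ (- (a * s)) + F 1 `^ (- s)).
Proof.
have x1 := singular_datum_ge1 x; have x0 := lt_le_trans ltr01 x1.
have Fx := tail_gt0 f_gt0 df tail_fin x0.
have C0 : 0 <= C.
  by apply: le_trans (growth x1); rewrite mulr_ge0 ?powR_ge0 ?(ltW x0).
apply: le_trans (ler_wpM2l C0 (tail_singular_datum_powRN x s0)).
by rewrite powRN ler_pdivlMr ?powR_gt0// growth.
Qed.

Lemma L1ul_singular_datum : a * s < N%:R -> L1ul singular_datum.
Proof.
move=> asN; have C0 : 0 <= C.
  by apply: le_trans (growth (lexx 1)); rewrite mul1r powR_ge0.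
apply: (@L1ul_of_le _ _ (a * s) (mulr_gt0 a0 s0) asN _ C (C * F 1 `^ (- s))) => //.
- exact: measurable_singular_datum.
- by rewrite mulr_ge0 ?powR_ge0.
move=> x; rewrite ger0_norm -?mulrDr ?singular_datum_le//.
exact: le_trans ler01 (singular_datum_ge1 x).
Qed.

Lemma L1ul_tail_singular_datum (e : R) : 0 < e -> a * e < N%:R ->
  L1ul (fun x => tail_int_pow f e (singular_datum x)).
Proof.
move=> e0 aeN.
have powE x : tail_int_pow f e (singular_datum x) = F (singular_datum x) `^ (- e).
  rewrite /tail_int_pow ifF// lt_eqF// tail_fin//.
  exact: lt_le_trans ltr01 (singular_datum_ge1 x).
apply: (@L1ul_of_le _ _ (a * e) (mulr_gt0 a0 e0) aeN _ 1 (F 1 `^ (- e))) => //.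
- rewrite (_ : (fun _ => _) = (fun z : R => F z `^ (- e)) \o singular_datum); last first.
    by apply/funext => x /=; rewrite powE.
  apply: (@measurable_comp _ _ _ _ _ _ (`]0, +oo[%classic : set R)) => //.
  - move=> _ [x _ <-]; rewrite /= in_itv/= andbT.
    exact: lt_le_trans ltr01 (singular_datum_ge1 x).
  - apply: (measurableT_comp (@measurable_powR R _)).
    apply: open_continuous_measurable_fun; first exact: interval_open.
    move=> z; rewrite inE/= in_itv/= andbT => z0.
    apply/differentiable_continuous/derivable1_diffP.
    by case: (is_derive_tail f_gt0 df tail_fin z0).
  - exact: measurable_singular_datum.
- by rewrite powR_ge0.
by move=> x; rewrite powE mul1r ger0_norm ?powR_ge0// tail_singular_datum_powRN.
Qed.

End singular_datum.

(** * Non-existence *)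

Lemma ae_meets_ball {R : realType} (N : nat) (t : R) (P : N.-tuple R -> Prop) :
  (0 < N)%N -> 0 < t -> {ae lebesgueN N, forall x, P x} ->
  exists2 x, enorm x ^+ 2 <= t & P x.
Proof.
move=> N0 t0 aeP.
have N0' : 0 < N%:R :> R by rewrite ltr0n.
pose e : R := Num.sqrt (t / N%:R).
have e0 : 0 < e by rewrite sqrtr_gt0 divr_gt0.
pose A : set (N.-tuple R) := [set x | forall i, `[- e, e]%classic (tnth x i)].
have mA : measurable A by apply: (@measurable_box _ _ (fun=> `[- e, e]%classic)).
have A0 : (0 < lebesgueN N A)%E.
  rewrite (@lebesgueN_box R N (fun=> `[- e, e]%classic))//.
  rewrite (eq_bigr (fun=> (2 * e)%:E)); last first.
    move=> i _; rewrite lebesgue_measure_itv/= lte_fin ifT; last by lra.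
    by rewrite -EFinB; congr EFin; ring.
  by rewrite prodEFin lte_fin prodr_gt0// => i _; rewrite mulr_gt0.
have [x Ax Px] := ae_meets aeP mA A0; exists x => //.
rewrite sqr_enorm (le_trans (y := \sum_(i < N) e ^+ 2))//.
  apply: ler_sum => i _; have := Ax i; rewrite /= in_itv/= -ler_norml => h.
  by rewrite -real_normK ?num_real// lerXn2r ?nnegrE// ltW.
rewrite sumr_const card_ord sqr_sqrtr; last exact: divr_ge0 (ltW t0) (ltW N0').
by rewrite -[_ *+ _]mulr_natr divfK// gt_eqF.
Qed.

Theorem theorem1p4 (R : realType) (N : nat) (gamma q r : R) (f : R -> R) :
  (1 <= N)%N ->
  0 < gamma < Num.min 2 N%:R ->
  C2_nneg f -> classS q f -> 1 <= q ->
  (exists delta : R, 0 < delta < 1 /\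
    forall xi : R, 0 < xi -> delta <= f xi * (f^`(2))%classic xi / (f^`())%classic xi ^+ 2) ->
  0 < r < N%:R / (2 - gamma) ->
  q <= 1 + r ->
  exists u0 : N.-tuple R -> R,
    [/\ forall x, 0 <= u0 x,
        L1ul u0,
        L1ul (fun x => tail_int_pow f r (u0 x)) &
        forall T : R, 0 < T ->
          ~ exists u : N.-tuple R -> R -> R, local_solution gamma f u0 T u].
Proof.
move=> N0 /andP[gamma0]; rewrite lt_min => /andP[gamma2 _].
move=> C2f [cf ddf _ fS limq] q1 [delta [/andP[delta0 delta1] convex]].
move=> /andP[r0 rN] qr.
have f_gt0 u : 0 < u -> 0 < f u by move=> /fS[].
have df_ge0 u : 0 < u -> 0 <= f^`()%classic u by move=> /fS[].
have tail_fin u : 0 < u -> (tail_int f u < +oo)%E by move=> /fS[].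
have df (u : R) : 0 < u -> is_derive u 1 f (f^`()%classic u).
  by move=> u0; apply: DeriveDef; [exact: ddf|rewrite derive1E].
have df1 := is_derive2_C2_nneg C2f.
have f_ge0 := continuous_nneg_ge0 cf f_gt0.
have mf : measurable_fun (`[0, +oo[%classic : set R) f.
  exact: subspace_continuous_measurable_fun.
have quot (u : R) : 0 < u ->
    delta * f^`()%classic u ^+ 2 <= f u * f^`(2)%classic u.
  move=> u0; have [f'0|f'0] := eqVneq (f^`()%classic u) 0.
    have := convex u u0; rewrite f'0 expr0n/= invr0 mulr0.
    by rewrite leNgt delta0.
  by rewrite -ler_pdivlMr ?convex// exprn_even_gt0.
have N0' : 0 < N%:R :> R by rewrite ltr0n.
have g20 : 0 < 2 - gamma by rewrite subr_gt0.

(* [2 - gamma < a] makes the datum too singular for a solution to exist, while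
   [a r < N] and [a s < N] keep [F(u0) ^ -r] and [u0] locally integrable. *)
pose a := (2 - gamma + N%:R / r) / 2.
have gN : 2 - gamma < N%:R / r.
  by rewrite ltr_pdivlMr// mulrC -ltr_pdivlMr.
have ga : 2 - gamma < a by rewrite /a; lra.
have aN : a < N%:R / r by rewrite /a; lra.
have a0 : 0 < a := lt_trans g20 ga.
have arN : a * r < N%:R by rewrite -ltr_pdivlMr.
pose s := (r + N%:R / a) / 2.
have rNa : r < N%:R / a by rewrite ltr_pdivlMr// mulrC.
have rs : r < s by rewrite /s; lra.
have sN : s < N%:R / a by rewrite /s; lra.
have s0 : 0 < s := lt_trans r0 rs.
have asN : a * s < N%:R by rewrite mulrC -ltr_pdivlMr.
have qs : q - 1 < s by lra.
have [C growth] := tail_growth f_gt0 df tail_fin s0 qs limq.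
have u01 := @singular_datum_ge1 R N f a.
have mu0 := @measurable_singular_datum R N f f_gt0 df tail_fin a s C a0 s0 growth.
exists (singular_datum f a); split.
- by move=> x; exact: le_trans ler01 (u01 x).
- exact: L1ul_singular_datum growth asN.
- exact: (L1ul_tail_singular_datum f_gt0 df tail_fin a0 s0 growth r0 arN).
move=> T T0 [u sol].
have [c c0 lower] := local_solution_lifespan N0 delta0 delta1 gamma0 f_ge0 f_gt0
  df df1 df_ge0 quot mf tail_fin.
have [K K0 upper] := tail_heat_le N0 f_gt0 df df_ge0 tail_fin a0.
pose e := a / 2 - (1 - gamma / 2).
have e0 : 0 < e by rewrite /e; lra.
pose t0 := Num.min T ((c / K) `^ e^-1).
have cK0 : 0 < c / K by rewrite divr_gt0.
have t00 : 0 < t0 by rewrite lt_min T0 powR_gt0.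
have mt0 : (0 < @lebesgue_measure R `]0%R, t0[%classic)%E.
  by rewrite lebesgue_measure_itv/= lte_fin t00 -EFinB lte_fin subr0.
have [t /=] := ae_meets (lower _ _ _ mu0 u01 sol) (measurable_itv `]0, t0[) mt0.
rewrite in_itv/= => /andP[t0' tt0].
have [tT tc] : t < T /\ t < (c / K) `^ e^-1 by apply/andP; rewrite -lt_min.
move=> tgood; have {tgood} := tgood (introT andP (conj t0' tT)).
move=> /(ae_meets_ball N0 t0')[x xt /(_ xt)[w hw low]].
have up := upper t x _ w t0' xt mu0 u01 _ hw.
have {}up : fine (tail_int f w) <= K * t `^ (a / 2).
  apply: up => y y0; rewrite (@tail_singular_datum R N f f_gt0 df tail_fin a s C s0 growth)//.
  by rewrite ge_min lexx.
have := le_trans low up; apply/negP; rewrite -ltNge.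
have -> : a / 2 = e + (1 - gamma / 2) by rewrite /e; ring.
rewrite powRD; last by rewrite (gt_eqF t0') implybT.
rewrite mulrA ltr_pM2r ?powR_gt0// mulrC -ltr_pdivlMr//.
have -> : c / K = ((c / K) `^ e^-1) `^ e.
  by rewrite -powRrM mulVf ?gt_eqF// powRr1 ?(ltW cK0).
by apply: gt0_ltr_powR => //; rewrite nnegrE ltW ?powR_gt0.
Qed.
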